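(* Let $n\ge1$, $\theta\in\mathbb{R}^n$, $\sigma^2>0$, $Y\sim\mathcal{N}(\theta,\sigma^2 I_n)$, and let $g:\mathbb{R}^n\to\mathbb{R}^n$ be measurable with $\mathbb{E}\|g(Y)\|_2^2<\infty$. Fix an integer $K\ge 2$ and, for $\alpha>0$, let $\mathrm{CV}_\alpha$ be the antithetic cross-validated estimator defined below. Then $$\lim_{\alpha\to 0}\mathbb{E}[\mathrm{CV}_\alpha]=\mathrm{PE}(g).$$
   Context: $\tilde Y$ denotes an independent copy of $Y$, and the prediction error is $\mathrm{PE}(g)=\mathbb{E}\|g(Y)-\tilde Y\|_2^2$. Antithetic randomization: $\omega^{(1)},\dots,\omega^{(K)}$ are jointly Gaussian random vectors in $\mathbb{R}^n$, independent of $Y$, with $\omega^{(k)}\sim\mathcal{N}(0,\sigma^2 I_n)$ for each $k$ and $\mathrm{Cov}(\omega^{(j)},\omega^{(k)})=-\frac{\sigma^2}{K-1}I_n$ for $j\neq k$ (so that $\sum_{k=1}^K\omega^{(k)}=0$ almost surely). For $\alpha>0$, $$\mathrm{CV}_\alpha=\frac1K\sum_{k=1}^K\Big(\big\|Y-\tfrac{1}{\sqrt\alpha}\omega^{(k)}-g(Y+\sqrt\alpha\,\omega^{(k)})\big\|_2^2-\tfrac1\alpha\|\omega^{(k)}\|_2^2\Big).$$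
   Formalization: The formal theorem additionally assumes that CV_α is integrable for all sufficiently small α > 0; without this the claim fails, e.g. for n = 1, θ = 0, g(y)² = exp(y²/(2σ²))/(1+y²), where E[CV_α] = +∞ for every α > 0. *)

(* Defs.v *)
From HB Require Import structures.
From mathcomp Require Import all_boot all_order all_algebra.
From mathcomp Require Import all_classical all_reals all_analysis.

Set Implicit Arguments.
Unset Strict Implicit.
Unset Printing Implicit Defensive.

Import Order.TTheory GRing.Theory Num.Theory.
Import numFieldNormedType.Exports.

Local Open Scope classical_set_scope.
Local Open Scope ring_scope.

(* Vectors of R^n are represented by n.-tuple R, which MathComp-Analysis
   equips with the product (= Borel) sigma-algebra generated by the
   coordinate projections. *)

Definition vadd (R : realType) (n : nat) (x y : n.-tuple R) : n.-tuple R :=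
  [tuple tnth x i + tnth y i | i < n].

Definition vsub (R : realType) (n : nat) (x y : n.-tuple R) : n.-tuple R :=
  [tuple tnth x i - tnth y i | i < n].

Definition vscale (R : realType) (n : nat) (a : R) (x : n.-tuple R) : n.-tuple R :=
  [tuple a * tnth x i | i < n].

Definition sqnorm (R : realType) (n : nat) (x : n.-tuple R) : R :=
  \sum_(i < n) tnth x i ^+ 2.

Definition gauss1 (R : realType) (m v : R) : set R -> \bar R :=
  if v == 0 then @dirac _ R m R else normal_prob m (Num.sqrt v).

Definition jointly_gaussian (d : measure_display) (T : measurableType d)
    (R : realType) (P : probability T R) (I : finType)
    (X : I -> T -> R) (m : I -> R) (C : I -> I -> R) : Prop :=
  (forall i, measurable_fun setT (X i)) /\
  forall (u : I -> R) (A : set R), measurable A ->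
    P ((fun t => \sum_(i : I) u i * X i t) @^-1` A) =
    gauss1 (\sum_(i : I) u i * m i)
           (\sum_(i : I) \sum_(j : I) u i * u j * C i j) A.

Definition independent_rv (d : measure_display) (T : measurableType d)
    (R : realType) (P : probability T R)
    (d1 : measure_display) (T1 : measurableType d1)
    (d2 : measure_display) (T2 : measurableType d2)
    (X : T -> T1) (Z : T -> T2) : Prop :=
  measurable_fun setT X /\ measurable_fun setT Z /\
  forall (A : set T1) (B : set T2), measurable A -> measurable B ->
    P (X @^-1` A `&` Z @^-1` B) = (P (X @^-1` A) * P (Z @^-1` B))%E.

Definition gaussian_vec (d : measure_display) (T : measurableType d)
    (R : realType) (P : probability T R) (n : nat)
    (Y : T -> n.-tuple R) (theta : n.-tuple R) (s2 : R) : Prop :=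
  jointly_gaussian P (fun i t => tnth (Y t) i) (fun i => tnth theta i)
    (fun i j => if i == j then s2 else 0).

Definition antithetic (d : measure_display) (T : measurableType d)
    (R : realType) (P : probability T R) (n K : nat)
    (w : 'I_K -> T -> n.-tuple R) (s2 : R) : Prop :=
  jointly_gaussian P (fun ki t => tnth (w ki.1 t) ki.2) (fun _ => 0)
    (fun ki lj => if ki.2 == lj.2 then
                    (if ki.1 == lj.1 then s2 else - (s2 / (K.-1)%:R))
                  else 0).

Definition omega_tuple (T : Type) (R : realType) (n K : nat)
    (w : 'I_K -> T -> n.-tuple R) : T -> K.-tuple (n.-tuple R) :=
  fun t => [tuple w k t | k < K].

Definition CV (T : Type) (R : realType) (n K : nat)
    (g : n.-tuple R -> n.-tuple R) (Y : T -> n.-tuple R)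
    (w : 'I_K -> T -> n.-tuple R) (alpha : R) : T -> R :=
  fun t => K%:R^-1 * \sum_(k < K)
    (sqnorm (vsub (vsub (Y t) (vscale (Num.sqrt alpha)^-1 (w k t)))
                  (g (vadd (Y t) (vscale (Num.sqrt alpha) (w k t)))))
     - alpha^-1 * sqnorm (w k t)).

(* Main.v *)
(* Put [c = E Y], [U = Y - w / sqrt alpha] and [V = Y + sqrt alpha w], where [w]
   is one of the noise vectors.  Only the law of each single pair [(Y, w)] matters
   for the expectation of [CV].  The pair [(U, V)] is Gaussian with covariance
   [s2 - s2 = 0], so [U] and [V] are independent, and expanding the squares around
   [c] gives [E CV_alpha = E|Y - c|^2 + E h(V)] with [h x = |g x - c|^2].  The same
   expansion gives [PE = E|Y - c|^2 + E h(Y)].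

   Integrability of [CV] at one [alpha0] makes [h] integrable for the law
   [N(theta, s2 (1 + alpha0))].  The laws [N(theta, s2 (1 + alpha))] with
   [0 <= alpha <= alpha0] have uniformly bounded densities with respect to it,
   which converge pointwise as [alpha] tends to [0]; dominated convergence
   concludes.

   Joint Gaussianity is known only through linear forms, so independence and
   densities rest on the Cramer-Wold theorem.  Its proof passes from the waves
   [cos (u.X + phi)] to indicators of half-spaces: polynomials in a slow sine wave
   converge boundedly to the indicator of [X_i < a]. *)

Require Import Defs.
From HB Require Import structures.
From mathcomp Require Import all_boot all_order all_algebra.
From mathcomp Require Import all_classical all_reals all_analysis.
From mathcomp Require Import measurable_realfun ring lra.

Import Order.TTheory GRing.Theory Num.Theory.
Import numFieldNormedType.Exports.

Local Open Scope classical_set_scope.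
Local Open Scope ring_scope.

Set Implicit Arguments.
Unset Strict Implicit.
Unset Printing Implicit Defensive.

Lemma bernoulli_ineq (R : realFieldType) (h : R) (m : nat) :
  0 <= 1 + h -> 1 + m%:R * h <= (1 + h) ^+ m.
Proof.
move=> h1; elim: m => [|m IH]; first by rewrite mul0r addr0 expr0.
rewrite exprS; apply: le_trans (ler_wpM2l h1 IH).
have : 0 <= m%:R * h ^+ 2 by rewrite mulr_ge0// sqr_ge0.
by rewrite -natr1; nra.
Qed.

Lemma cvg_natmul_expr (R : realType) (z : R) : 0 <= z < 1 ->
  m%:R * z ^+ m @[m --> \oo] --> (0 : R).
Proof.
move=> /andP[z0 z1].
have [->|zn0] := eqVneq z 0.
  apply: cvg_near_cst; near=> m; rewrite expr0n.
  by rewrite gtn_eqF ?mulr0//; near: m; exact: nbhs_infty_gt.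
have zp : 0 < z by rewrite lt_neqAle eq_sym zn0.
pose w := Num.sqrt z.
have w0 : 0 < w by rewrite sqrtr_gt0.
have wz : w ^+ 2 = z by rewrite sqr_sqrtr.
have w1 : w < 1 by rewrite -(@ltr_pXn2r _ 2%N) ?nnegrE ?ltW// expr1n wz.
pose h := w^-1 - 1.
have h0 : 0 < h by rewrite subr_gt0 invf_gt1.
have mw m : m%:R * w ^+ m <= h^-1.
  have := @bernoulli_ineq _ h m; rewrite /h subrKC invr_ge0 ltW// => /(_ isT).
  rewrite -/h exprVn -[X in _ <= X]div1r ler_pdivlMr ?exprn_gt0// => H.
  rewrite -[leRHS]div1r ler_pdivlMr//; apply: le_trans H.
  by have := exprn_ge0 m (ltW w0); nra.
apply: (@squeeze_cvgr _ _ _ _ (cst 0) (fun m => h^-1 * w ^+ m)).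
- apply: nearW => m /=; rewrite mulr_ge0 ?exprn_ge0//=.
  rewrite -wz -exprM mulnC exprM expr2 mulrA ler_wpM2r// exprn_ge0// ltW//.
- exact: cvg_cst.
- rewrite -[X in _ --> X](mulr0 h^-1); apply: cvgMr.
  by apply: cvg_expr; rewrite ger0_norm// ltW.
Unshelve. all: by end_near. Qed.

(* The Brosowski-Deutsch polynomials; the factor [m] in the exponent settles
   the borderline value [t = 1/2]. *)
Definition step_poly (R : realType) (m : nat) (t : R) : R :=
  (1 - t ^+ m) ^+ (m * 2 ^ m).

Lemma step_poly_itv (R : realType) (m : nat) (t : R) :
  0 <= t <= 1 -> 0 <= step_poly m t <= 1.
Proof.
move=> /andP[t0 t1]; rewrite /step_poly.
have a1 : t ^+ m <= 1 by rewrite exprn_ile1.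
have a0 : 0 <= t ^+ m by rewrite exprn_ge0.
by rewrite exprn_ge0 ?subr_ge0//= exprn_ile1 ?subr_ge0// gerBl.
Qed.

Lemma cvg_step_poly (R : realType) (t : R) : 0 <= t <= 1 ->
  step_poly m t @[m --> \oo] --> ((t < 2^-1)%R%:R : R).
Proof.
move=> /[dup] t01 /andP[t0 t1].
have twom m : (2 ^ m)%N%:R * t ^+ m = (2 * t) ^+ m by rewrite natrX exprMn.
have [th|th] := ltP t 2^-1; rewrite /=.
- apply: (@squeeze_cvgr _ _ _ _ (fun m => 1 - m%:R * (2 * t) ^+ m) (cst 1)).
  + apply: nearW => m /=; apply/andP; split; last by case/andP: (step_poly_itv m t01).
    have := @bernoulli_ineq _ (- t ^+ m) (m * 2 ^ m); rewrite subr_ge0 exprn_ile1//.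
    by move=> /(_ isT); rewrite mulrN natrM -mulrA twom.
  + rewrite -[X in _ --> X]subr0; apply: cvgB; first exact: cvg_cst.
    apply: cvg_natmul_expr; rewrite mulr_ge0//=.
    by rewrite mulrC -ltr_pdivlMr// div1r.
  + exact: cvg_cst.
- apply: (@squeeze_cvgr _ _ _ _ (cst 0) (fun m => harmonic m)).
  + apply: nearW => m /=; apply/andP; split; first by case/andP: (step_poly_itv m t01).
    rewrite /harmonic -div1r ler_pdivlMr//.
    have tm0 : 0 <= t ^+ m by rewrite exprn_ge0.
    have tm1 : t ^+ m <= 1 by rewrite exprn_ile1.
    have B := @bernoulli_ineq _ (t ^+ m) (m * 2 ^ m) (addr_ge0 ler01 tm0).
    rewrite natrM -mulrA twom in B.
    have H : 1 <= (2 * t) ^+ m.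
      by rewrite exprn_ege1// mulrC -ler_pdivrMr// div1r.
    have H2 : m.+1%:R <= (1 + t ^+ m) ^+ (m * 2 ^ m).
      apply: le_trans B; rewrite -natr1 addrC lerD2l.
      by rewrite ler_peMr.
    have s0 : 0 <= step_poly m t by case/andP: (step_poly_itv m t01).
    apply: (le_trans (ler_wpM2l s0 H2)).
    rewrite /step_poly -exprMn; apply: exprn_ile1.
      by rewrite mulr_ge0 ?subr_ge0// addr_ge0.
    by nra.
  + exact: cvg_cst.
  + exact: cvg_harmonic.
Qed.

Lemma bounded_integrable (R : realType) (d : measure_display)
    (T : measurableType d) (mu : {measure set T -> \bar R}) (f : T -> R) (M : R) :
  (mu setT < +oo)%E -> measurable_fun setT f -> (forall t, `|f t| <= M) ->
  mu.-integrable setT (EFin \o f).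
Proof.
move=> fm mf fM; apply: (@le_integrable _ _ _ _ _ _ _ (EFin \o cst M)) => //.
- exact/measurable_EFinP.
- by move=> t _; rewrite /= lee_fin (le_trans (fM t))// ler_norm.
- apply/integrableP; split; first exact/measurable_EFinP.
  rewrite (eq_integral (cst `|M|%:E))// integral_cst//.
  by rewrite lte_mul_pinfty.
Qed.

Section eq_law.
Context (R : realType) (d d' d0 : measure_display)
  (T : measurableType d) (T' : measurableType d') (U : measurableType d0)
  (mu : {measure set T -> \bar R}) (mu' : {measure set T' -> \bar R})
  (X : T -> U) (X' : T' -> U).
Hypothesis (mX : measurable_fun setT X) (mX' : measurable_fun setT X').
Hypothesis XX' : forall B, measurable B -> mu (X @^-1` B) = mu' (X' @^-1` B).

Let integral_pushforward_eq (f : U -> \bar R) :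
  (\int[pushforward mu X]_x f x = \int[pushforward mu' X']_x f x)%E.
Proof.
by apply: (eq_measure_integral (Measure.clone _ _ _ (pushforward mu' X') _)) => A mA _;
  exact: XX'.
Qed.

Lemma ge0_eq_law_integral (f : U -> \bar R) :
  measurable_fun setT f -> (forall x, 0 <= f x)%E ->
  (\int[mu]_t f (X t) = \int[mu']_t f (X' t))%E.
Proof.
move=> mf f0.
by rewrite -(ge0_integral_pushforward mX mu (D := setT))// integral_pushforward_eq
  ge0_integral_pushforward.
Qed.

Lemma eq_law_integrable (f : U -> \bar R) : measurable_fun setT f ->
  mu.-integrable setT (f \o X) -> mu'.-integrable setT (f \o X').
Proof.
move=> mf /integrableP[_ fX]; apply/integrableP; split.
  exact: measurableT_comp.
rewrite -(@ge0_eq_law_integral (fun x => `|f x|)%E)//.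
exact: measurableT_comp.
Qed.

Lemma eq_law_integral (f : U -> \bar R) : measurable_fun setT f ->
  mu.-integrable setT (f \o X) -> (\int[mu]_t f (X t) = \int[mu']_t f (X' t))%E.
Proof.
move=> mf fX; have fX' := eq_law_integrable mf fX.
by rewrite -(integral_pushforward mX mf (D := setT))// integral_pushforward_eq
  integral_pushforward.
Qed.

End eq_law.

Definition lincomb (R : realType) (I : finType) (T : Type) (X : I -> T -> R)
    (u : I -> R) (t : T) : R :=
  \sum_i u i * X i t.

Section lincomb.
Context (R : realType) (d : measure_display) (T : measurableType d)
  (mu : {measure set T -> \bar R}) (I : finType) (X : I -> T -> R).
Hypothesis mX : forall i, measurable_fun setT (X i).

Lemma measurable_lincomb (u : I -> R) : measurable_fun setT (lincomb X u).
Proof. by apply: measurable_sum => i; exact: measurable_funM. Qed.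

Lemma measurable_cos_lincomb (u : I -> R) (phi : R) :
  measurable_fun setT (fun t => cos (lincomb X u t + phi)).
Proof.
apply: (measurableT_comp (f := cos)).
  by apply: continuous_measurable_fun; exact: continuous_cos.
by apply: measurable_funD => //; exact: measurable_lincomb.
Qed.

Lemma integrable_cos_lincomb (F : T -> R) (M : R) (u : I -> R) (phi : R) :
  (mu setT < +oo)%E -> measurable_fun setT F -> (forall t, `|F t| <= M) ->
  mu.-integrable setT (EFin \o (fun t => F t * cos (lincomb X u t + phi))).
Proof.
move=> fm mF FM; apply: (@bounded_integrable _ _ _ _ _ M) => //.
  by apply: measurable_funM => //; exact: measurable_cos_lincomb.
move=> t; rewrite normrM -[leRHS]mulr1 ler_pM//; exact: cos_max.
Qed.

End lincomb.

Section cramer_wold.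
Context (R : realType) (d d' : measure_display)
  (T : measurableType d) (T' : measurableType d')
  (mu : {measure set T -> \bar R}) (mu' : {measure set T' -> \bar R})
  (I : finType) (X : I -> T -> R) (X' : I -> T' -> R).
Hypothesis (fmu : (mu setT < +oo)%E) (fmu' : (mu' setT < +oo)%E).
Hypothesis (mX : forall i, measurable_fun setT (X i))
           (mX' : forall i, measurable_fun setT (X' i)).

Definition same_transform (F : T -> R) (F' : T' -> R) : Prop :=
  [/\ measurable_fun setT F, measurable_fun setT F',
      exists M, (forall t, `|F t| <= M) /\ (forall t, `|F' t| <= M) &
      forall u phi, (\int[mu]_t (F t * cos (lincomb X u t + phi))%:E =
                     \int[mu']_t (F' t * cos (lincomb X' u t + phi))%:E)%E].

Lemma same_transform_lin F F' G G' (a b : R) :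
  same_transform F F' -> same_transform G G' ->
  same_transform (fun t => a * F t + b * G t) (fun t => a * F' t + b * G' t).
Proof.
move=> [mF mF' [M [FM FM']] FF] [mG mG' [N [GN GN']] GG]; split.
- by apply: measurable_funD; apply: measurable_funM.
- by apply: measurable_funD; apply: measurable_funM.
- by exists (`|a| * M + `|b| * N); split=> t;
    rewrite (le_trans (ler_normD _ _))// !normrM lerD// ler_wpM2l.
- have E (d0 : measure_display) (U : measurableType d0)
      (m : {measure set U -> \bar R}) (Z : I -> U -> R) (H K : U -> R) u phi :
      (m setT < +oo)%E -> (forall i, measurable_fun setT (Z i)) ->
      measurable_fun setT H -> (forall t, `|H t| <= M) ->
      measurable_fun setT K -> (forall t, `|K t| <= N) ->
      (\int[m]_t ((a * H t + b * K t) * cos (lincomb Z u t + phi))%:E =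
       a%:E * \int[m]_t (H t * cos (lincomb Z u t + phi))%:E +
       b%:E * \int[m]_t (K t * cos (lincomb Z u t + phi))%:E)%E.
    move=> fm mZ mH HM mK KN.
    have iH := integrable_cos_lincomb mZ u phi fm mH HM.
    have iK := integrable_cos_lincomb mZ u phi fm mK KN.
    rewrite -!integralZl// -integralD//; [|exact: integrableZl..].
    by apply: eq_integral => t _; rewrite -!EFinM -EFinD; congr EFin; ring.
  by move=> u phi; rewrite !E// FF GG.
Qed.

Lemma same_transform_wave F F' v psi : same_transform F F' ->
  same_transform (fun t => F t * cos (lincomb X v t + psi))
                 (fun t => F' t * cos (lincomb X' v t + psi)).
Proof.
move=> [mF mF' [M [FM FM']] FF]; split.
- by apply: measurable_funM => //; exact: measurable_cos_lincomb.
- by apply: measurable_funM => //; exact: measurable_cos_lincomb.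
- by exists M; split=> t; rewrite normrM -[leRHS]mulr1 ler_pM//; exact: cos_max.
- have E (d0 : measure_display) (U : measurableType d0)
      (m : {measure set U -> \bar R}) (Z : I -> U -> R) (H : U -> R) u phi :
      (m setT < +oo)%E -> (forall i, measurable_fun setT (Z i)) ->
      measurable_fun setT H -> (forall t, `|H t| <= M) ->
      (\int[m]_t (H t * cos (lincomb Z v t + psi) * cos (lincomb Z u t + phi))%:E =
       2^-1%:E * \int[m]_t (H t * cos (lincomb Z (v \+ u) t + (psi + phi)))%:E +
       2^-1%:E * \int[m]_t (H t * cos (lincomb Z (v \- u) t + (psi - phi)))%:E)%E.
    move=> fm mZ mH HM.
    rewrite -!integralZl//; [|exact: (integrable_cos_lincomb mZ _ _ fm mH HM)..].
    rewrite -integralD//;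
      [|by apply: integrableZl => //; exact: (integrable_cos_lincomb mZ _ _ fm mH HM)..].
    apply: eq_integral => t _; rewrite -!EFinM -EFinD; congr EFin.
    have -> : lincomb Z (v \+ u) t + (psi + phi) =
        (lincomb Z v t + psi) + (lincomb Z u t + phi).
      rewrite /lincomb; under eq_bigr do rewrite mulrDl.
      by rewrite big_split/=; ring.
    have -> : lincomb Z (v \- u) t + (psi - phi) =
        (lincomb Z v t + psi) - (lincomb Z u t + phi).
      rewrite /lincomb; under eq_bigr do rewrite mulrBl.
      by rewrite big_split/= sumrN; ring.
    move: (_ + psi) (_ + phi) => x y.
    by rewrite cosB cosD; field.
  by move=> u phi; rewrite !E// !FF.
Qed.

Lemma same_transform_lim (F_ : nat -> T -> R) (F'_ : nat -> T' -> R)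
    (F : T -> R) (F' : T' -> R) (M : R) :
  (forall n, same_transform (F_ n) (F'_ n)) ->
  (forall n t, `|F_ n t| <= M) -> (forall n t, `|F'_ n t| <= M) ->
  (forall t, F_ n t @[n --> \oo] --> F t) ->
  (forall t, F'_ n t @[n --> \oo] --> F' t) -> same_transform F F'.
Proof.
move=> FF FM FM' Fc Fc'.
have lim_le (u : nat -> R) (l : R) :
    (forall n, `|u n| <= M) -> u n @[n --> \oo] --> l -> `|l| <= M.
  move=> uM ul.
  have ul' : `|u n| @[n --> \oo] --> `|l| by exact: cvg_norm.
  by rewrite -(cvg_lim _ ul')//; apply: limr_le; [exact: cvgP ul'|exact: nearW].
split.
- by apply: (measurable_fun_cvg _ (fun t _ => Fc t)) => n; case: (FF n).
- by apply: (measurable_fun_cvg _ (fun t _ => Fc' t)) => n; case: (FF n).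
- by exists M; split=> t; [apply: lim_le (Fc t) => n|apply: lim_le (Fc' t) => n].
- move=> u phi.
  have E (d0 : measure_display) (U : measurableType d0)
      (m : {measure set U -> \bar R}) (Z : I -> U -> R) (H_ : nat -> U -> R)
      (H : U -> R) :
      (m setT < +oo)%E -> (forall i, measurable_fun setT (Z i)) ->
      (forall n, measurable_fun setT (H_ n)) -> (forall n t, `|H_ n t| <= M) ->
      (forall t, H_ n t @[n --> \oo] --> H t) ->
      (\int[m]_t (H_ n t * cos (lincomb Z u t + phi))%:E @[n --> \oo] -->
       \int[m]_t (H t * cos (lincomb Z u t + phi))%:E)%E.
    move=> fm mZ mH HM Hc.
    apply: (@dominated_cvg _ _ _ _ _ _ _ _ (EFin \o cst M)) => //.
    + move=> n; apply/measurable_EFinP/measurable_funM => //.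
      exact: measurable_cos_lincomb.
    + move=> t _; apply: cvg_EFin; first exact: nearW.
      by apply: cvgMl; exact: Hc.
    + apply: (@bounded_integrable _ _ _ _ _ `|M|) => //.
    + move=> n t _; rewrite /= lee_fin normrM -[leRHS]mulr1 ler_pM//.
      exact: cos_max.
  have mF n : measurable_fun setT (F_ n) by case: (FF n).
  have mF' n : measurable_fun setT (F'_ n) by case: (FF n).
  have c1 := E _ _ mu X F_ F fmu mX mF FM Fc.
  have c2 := E _ _ mu' X' F'_ F' fmu' mX' mF' FM' Fc'.
  apply: (cvg_unique _ c1); first exact: ereal_hausdorff.
  apply: cvg_trans c2; apply: near_eq_cvg; apply: nearW => n.
  by case: (FF n) => _ _ _ ->.
Qed.

Lemma same_transform_ext F F' G G' : F =1 G -> F' =1 G' ->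
  same_transform F F' -> same_transform G G'.
Proof. by move=> /funext <- /funext <-. Qed.

Let half_wave (a : R) (L : nat) (x : R) : R := (1 + sin ((x - a) / L.+1%:R)) / 2.

Let half_wave_itv a L x : 0 <= half_wave a L x <= 1.
Proof.
rewrite /half_wave; set s := sin _.
have : -1 <= s <= 1 by rewrite sin_geN1 sin_le1.
by move=> /andP[s1 s2]; apply/andP; split; lra.
Qed.

Lemma same_transform_half_wave F F' i a L : same_transform F F' ->
  same_transform (fun t => F t * half_wave a L (X i t))
                 (fun t => F' t * half_wave a L (X' i t)).
Proof.
move=> FF.
pose u j : R := (j == i)%:R * L.+1%:R^-1.
pose psi : R := - (a / L.+1%:R) - pi / 2.
have E (U : Type) (Z : I -> U -> R) t :
    half_wave a L (Z i t) = 2^-1 + 2^-1 * cos (lincomb Z u t + psi).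
  rewrite /half_wave /psi /lincomb (bigD1 i)//= big1 ?addr0.
    by rewrite /u eqxx mul1r addrA cosBpihalf mulrBl mulrC [_^-1 * Z _ _]mulrC mulrDr mulr1.
  by move=> j ji; rewrite /u (negbTE ji) !mul0r.
apply: same_transform_ext (same_transform_lin 2^-1 2^-1 FF
  (same_transform_wave u psi FF)) => t; rewrite E; ring.
Qed.

Lemma same_transform_step_poly F F' i a L m : same_transform F F' ->
  same_transform (fun t => F t * step_poly m (half_wave a L (X i t)))
                 (fun t => F' t * step_poly m (half_wave a L (X' i t))).
Proof.
move=> FF0; rewrite /step_poly.
have expn G G' k : same_transform G G' ->
    same_transform (fun t => G t * half_wave a L (X i t) ^+ k)
                   (fun t => G' t * half_wave a L (X' i t) ^+ k).
  move=> GG; elim: k => [|k IH].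
    by apply: same_transform_ext GG => t; rewrite expr0 mulr1.
  by apply: same_transform_ext (same_transform_half_wave i a L IH) => t;
    rewrite exprSr mulrA.
elim: (m * 2 ^ m)%N => [|k IH].
  by apply: same_transform_ext FF0 => t; rewrite expr0 mulr1.
by apply: same_transform_ext (same_transform_lin 1 (-1) IH (expn _ _ m IH)) => t;
  rewrite exprSr; ring.
Qed.

Lemma same_transform_lt F F' i a : same_transform F F' ->
  same_transform (fun t => F t * (X i t < a)%R%:R)
                 (fun t => F' t * (X' i t < a)%R%:R).
Proof.
move=> FF; case: (FF) => mF mF' [M [FM FM']] _.
have bnd (f c : R) : `|f| <= M -> 0 <= c <= 1 -> `|f * c| <= M.
  move=> fM /andP[c0 c1]; rewrite normrM -[leRHS]mulr1 ler_pM//.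
  by rewrite ger0_norm.
pose G (U : Type) (Z : U -> R) (H : U -> R) (L : nat) t : R :=
  H t * (half_wave a L (Z t) < 2^-1)%R%:R.
have step L : same_transform (G _ (X i) F L) (G _ (X' i) F' L).
  apply: (@same_transform_lim
    (fun m t => F t * step_poly m (half_wave a L (X i t)))
    (fun m t => F' t * step_poly m (half_wave a L (X' i t))) _ _ M).
  - by move=> m; exact: same_transform_step_poly.
  - by move=> m t; apply: bnd => //; exact/step_poly_itv/half_wave_itv.
  - by move=> m t; apply: bnd => //; exact/step_poly_itv/half_wave_itv.
  - by move=> t; apply: cvgMr; exact/cvg_step_poly/half_wave_itv.
  - by move=> t; apply: cvgMr; exact/cvg_step_poly/half_wave_itv.
have sgn (x : R) : \forall L \near \oo, (half_wave a L x < 2^-1) = (x < a).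
  near=> L.
  have L0 : 0 < L.+1%:R :> R by [].
  have xaL : `|x - a| < L.+1%:R.
    apply: (@lt_le_trans _ _ L%:R); last by rewrite ler_nat.
    by near: L; exact: nbhs_infty_gtr.
  have pi1 : 1 < pi :> R by apply: lt_le_trans (pi_ge2 R); rewrite ltr1n.
  have yP (y : R) : 0 < y -> y < L.+1%:R -> 0 < sin (y / L.+1%:R).
    move=> y0 yL; apply: sin_gt0_pi; rewrite divr_gt0//=.
    by apply: lt_trans pi1; rewrite ltr_pdivrMr// mul1r.
  rewrite /half_wave; have [xa|xa|->] := ltgtP x a.
  - have := yP (a - x); rewrite subr_gt0 xa => /(_ isT).
    rewrite -opprB mulNr sinN.
    have -> : - (x - a) < L.+1%:R.
      by move: xaL; rewrite ltr_norml => /andP[? _]; rewrite ltrNl.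
    by move=> /(_ isT) H; apply/idP; lra.
  - have := yP (x - a); rewrite subr_gt0 xa => /(_ isT).
    rewrite (le_lt_trans (ler_norm _) xaL) => /(_ isT) H.
    by apply/negP; lra.
  - by rewrite subrr mul0r sin0 addr0 div1r ltxx.
apply: (@same_transform_lim (G _ (X i) F) (G _ (X' i) F') _ _ M) => //.
- by move=> L t; apply: bnd => //; case: (_ < _) => /=; rewrite ?lexx ?ler01.
- by move=> L t; apply: bnd => //; case: (_ < _) => /=; rewrite ?lexx ?ler01.
- move=> t; apply: cvg_near_cst; near=> L; rewrite /G; congr (_ * _%:R).
  by congr nat_of_bool; near: L; exact: sgn.
- move=> t; apply: cvg_near_cst; near=> L; rewrite /G; congr (_ * _%:R).
  by congr nat_of_bool; near: L; exact: sgn.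
Unshelve. all: by end_near. Qed.

Lemma same_transform_set F F' i (B : set R) :
  measurable B -> same_transform F F' ->
  same_transform (fun t => F t * \1_B (X i t)) (fun t => F' t * \1_B (X' i t)).
Proof.
move=> mB FF; case: (FF) => mF mF' [M [FM FM']] _.
have mE : @measurable _ R = <<s @RGenInftyO.G R >>.
  exact: RGenInftyO.measurableE.
move: mB; rewrite mE; move: B.
apply: (@dynkin_induction _ _ (@RGenInftyO.G R) (fun B => same_transform
  (fun t => F t * \1_B (X i t)) (fun t => F' t * \1_B (X' i t)))).
- exact: mE.
- move=> _ _ [a ->] [b ->]; exists (Num.min a b); apply/seteqP; split=> x /=;
    by rewrite !in_itv/= lt_min => /andP.
- by apply: same_transform_ext FF => t; rewrite indicT mulr1.
- move=> _ [a ->]; apply: same_transform_ext (same_transform_lt i a FF) => t;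
    by rewrite indicE mem_setE in_itv.
- move=> S _ HS; apply: same_transform_ext (same_transform_lin 1 (-1) FF HS) => t;
    rewrite !indicE in_setC; case: (_ \in _) => /=; ring.
- move=> S _ tS HS.
  pose G n (x : R) : R := \sum_(k < n) \1_(S k) x.
  have GE x : (forall n, G n x = 0) /\ ~ (\bigcup_k S k) x \/
      exists2 k0 : nat, (\bigcup_k S k) x & forall n, G n x = (k0 < n)%N%:R.
    have [[k0 _ Sx]|nS] := pselect ((\bigcup_k S k) x); last first.
      left; split => // n; apply: big1 => k _; rewrite indicE memNset// => Sx.
      by apply: nS; exists k.
    right; exists k0; first by exists k0.
    elim=> [|n IH]; first by rewrite /G big_ord0.
    rewrite /G big_ord_recr/= -/(G n x) IH indicE ltnS.
    have -> : (x \in S n) = (k0 == n).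
      apply/idP/eqP; last by move=> <-; rewrite inE.
      rewrite inE => Snx; apply: (tS k0 n) => //.
      by exists x.
    by case: (ltngtP k0 n) => _ /=; rewrite ?addr0 ?add0r.
  have G01 n x : 0 <= G n x <= 1.
    have [[-> _]|[k0 _ ->]] := GE x; first by rewrite lexx ler01.
    by case: (_ < _)%N; rewrite ?lexx ?ler01.
  have Gc x : G n x @[n --> \oo] --> (\1_(\bigcup_k S k) x : R).
    apply: cvg_near_cst; have [[G0 nS]|[k0 Sx G1]] := GE x.
      by apply: nearW => n; rewrite G0 indicE memNset.
    near=> n; rewrite G1 indicE mem_set//.
    suff -> : (k0 < n)%N by [].
    by near: n; exact: nbhs_infty_gt.
  have bnd (f c : R) : `|f| <= M -> 0 <= c <= 1 -> `|f * c| <= M.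
    move=> fM /andP[c0 c1]; rewrite normrM -[leRHS]mulr1 ler_pM//.
    by rewrite ger0_norm.
  apply: (@same_transform_lim (fun n t => F t * G n (X i t))
    (fun n t => F' t * G n (X' i t)) _ _ M).
  + elim=> [|n IH].
      by apply: same_transform_ext (same_transform_lin 0 0 FF FF) => t;
        rewrite /G big_ord0 mulr0 !mul0r addr0.
    by apply: same_transform_ext (same_transform_lin 1 1 IH (HS n)) => t;
      rewrite /G big_ord_recr/= !mul1r mulrDr.
  + by move=> n t; exact: bnd.
  + by move=> n t; exact: bnd.
  + by move=> t; apply: cvgMr; exact: Gc.
  + by move=> t; apply: cvgMr; exact: Gc.
Unshelve. all: by end_near. Qed.

Lemma cramer_wold :
  (forall (u : I -> R) (B : set R), measurable B ->
    mu (lincomb X u @^-1` B) = mu' (lincomb X' u @^-1` B)) ->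
  forall B : I -> set R, (forall i, measurable (B i)) ->
    mu [set t | forall i, B i (X i t)] = mu' [set t | forall i, B i (X' i t)].
Proof.
move=> H B mB.
have H1 : same_transform (cst 1) (cst 1).
  split => //; first by exists 1; split=> t; rewrite normr1.
  move=> u phi.
  have E := @eq_law_integral _ _ _ _ _ _ _ mu mu' (lincomb X u) (lincomb X' u)
    (measurable_lincomb mX u) (measurable_lincomb mX' u) (H u)
    (EFin \o (fun x => 1 * cos (x + phi))).
  apply: E.
    apply/measurable_EFinP/measurable_funM => //.
    apply: (measurableT_comp (f := cos)); last exact: measurable_funD.
    by apply: continuous_measurable_fun; exact: continuous_cos.
  apply: (integrable_cos_lincomb mX u phi fmu (F := cst 1) (M := 1)) => //.
  by move=> t; rewrite normr1.
have prod (s : seq I) : same_transform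
    (fun t => \prod_(i <- s) \1_(B i) (X i t))
    (fun t => \prod_(i <- s) \1_(B i) (X' i t)).
  elim: s => [|i s IH].
    by apply: same_transform_ext H1 => t; rewrite big_nil.
  by apply: same_transform_ext (same_transform_set i (mB i) IH) => t;
    rewrite big_cons mulrC.
case: (prod (index_enum I)) => _ _ _ /(_ (fun=> 0) 0).
have E (d0 : measure_display) (U : measurableType d0)
      (m : {measure set U -> \bar R}) (Z : I -> U -> R) :
      (forall i, measurable_fun setT (Z i)) ->
   (\int[m]_t (\prod_i \1_(B i) (Z i t) * cos (lincomb Z (fun=> 0) t + 0))%:E =
    m [set t | forall i, B i (Z i t)])%E.
  move=> mZ; rewrite -[X in _ = m X]setIT -integral_indic//; last first.
    rewrite (_ : mkset _ = \bigcap_(i in [set: I]) (Z i @^-1` B i)); last first.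
      by apply/seteqP; split=> t Ht i; [move=> _|]; exact: Ht.
    apply: fin_bigcap_measurable => // i _.
    by rewrite -[X in measurable X]setTI; exact: mZ.
  apply: eq_integral => t _; congr EFin.
  have -> : lincomb Z (fun=> 0) t = 0 by apply: big1 => i _; rewrite mul0r.
  rewrite addr0 cos0 mulr1.
  have [Zt|/existsNP[i nZ]] := pselect (forall i, B i (Z i t)).
    rewrite indicE mem_set// big1// => i _; rewrite indicE mem_set//; exact: Zt.
  rewrite indicE memNset; last by move=> /(_ i).
  by rewrite (bigD1 i)//= indicE memNset// mul0r.
by rewrite !E.
Qed.

End cramer_wold.

Definition box (R : realType) (n : nat) (B : 'I_n -> set R) : set (n.-tuple R) :=
  [set x | forall i, B i (tnth x i)].

Lemma measurable_box (R : realType) (n : nat) (B : 'I_n -> set R) :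
  (forall i, measurable (B i)) -> measurable (box B).
Proof.
move=> mB.
rewrite (_ : box B = \bigcap_(i in [set: 'I_n]) ((fun x => tnth x i) @^-1` B i)).
  apply: fin_bigcap_measurable => // i _.
  by rewrite -[X in measurable X]setTI; exact: measurable_tnth.
by apply/seteqP; split=> x xB i; [move=> _|]; exact: xB.
Qed.

Lemma measurable_tuple_box (R : realType) (n : nat) :
  @measurable _ (n.-tuple R) =
  <<s [set box B | B in [set B : 'I_n -> set R | forall i, measurable (B i)]] >>.
Proof.
apply/seteqP; split.
- apply: smallest_sub; first exact: smallest_sigma_algebra.
  rewrite -bigcup_seq; apply: bigcup_sub => i _ _ [A mA <-].
  apply: sub_sigma_algebra; exists (fun j => if j == i then A else setT).
    by move=> j /=; case: ifP.
  apply/seteqP; split=> x /=.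
    by move=> /(_ i); rewrite eqxx.
  by move=> [_ xA] j; case: ifPn => // /eqP ->.
- apply: smallest_sub; first exact: sigma_algebra_measurable.
  by move=> _ [B mB <-]; exact: measurable_box.
Qed.

Lemma tuple_measure_unique (R : realType) (n : nat)
    (m1 m2 : {measure set (n.-tuple R) -> \bar R}) :
  (m1 setT < +oo)%E ->
  (forall B : 'I_n -> set R, (forall i, measurable (B i)) ->
    m1 (box B) = m2 (box B)) ->
  forall A, measurable A -> m1 A = m2 A.
Proof.
move=> m1oo m12; apply: (measure_unique _ (fun=> setT) (measurable_tuple_box R n)).
- move=> _ _ [B mB <-] [C mC <-]; exists (fun i => B i `&` C i).
    by move=> i; exact: measurableI.
  apply/seteqP; split=> x /=.
    by move=> H; split=> i; case: (H i).
  by move=> [H1 H2] i; split; [exact: H1|exact: H2].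
- by move=> _; exists (fun=> setT) => //; apply/seteqP; split.
- by rewrite bigcup_const//; exists 0%N.
- by move=> _ [B mB <-]; exact: m12.
- by [].
Qed.

Section density.
Context (R : realType) (d : measure_display) (T : measurableType d)
  (mu nu : {measure set T -> \bar R}) (rho : T -> R).
Hypothesis mrho : measurable_fun setT rho.
Hypothesis rho_ge0 : forall x, 0 <= rho x.
Hypothesis nuE : forall A, measurable A -> (nu A = \int[mu]_(x in A) (rho x)%:E)%E.

Import HBNNSimple.

Lemma ge0_integral_density (f : T -> \bar R) :
  measurable_fun setT f -> (forall x, 0 <= f x)%E ->
  (\int[nu]_x f x = \int[mu]_x (f x * (rho x)%:E))%E.
Proof.
move=> mf f0; pose h := nnsfun_approx measurableT mf.
have hf x : (h n x)%:E @[n --> \oo] --> f x.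
  by apply: cvg_nnsfun_approx => // y _; exact: f0.
have -> : (\int[nu]_x f x = lim (\int[nu]_x (h n x)%:E @[n --> \oo]))%E.
  under eq_integral => x _ do rewrite -(cvg_lim _ (hf x))//.
  apply: monotone_convergence => //.
  - by move=> n; exact/measurable_EFinP.
  - by move=> n x _; rewrite lee_fin.
  - by move=> x _ a b ab; rewrite lee_fin; exact/lefP/nd_nnsfun_approx.
have -> : (\int[mu]_x (f x * (rho x)%:E) =
    lim (\int[mu]_x ((h n x)%:E * (rho x)%:E) @[n --> \oo]))%E.
  have fg x : ((h n x)%:E * (rho x)%:E)%E @[n --> \oo] --> (f x * (rho x)%:E)%E.
    by apply: cvgeZr => //; exact: hf.
  under eq_integral => x _ do rewrite -(cvg_lim _ (fg x))//.
  apply: monotone_convergence => //.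
  - by move=> n; apply/measurable_EFinP/measurable_funM.
  - by move=> n x _; rewrite -EFinM lee_fin mulr_ge0.
  - move=> x _ a b ab; rewrite -!EFinM lee_fin ler_wpM2r//.
    exact/lefP/nd_nnsfun_approx.
suff hE n : (\int[nu]_x (h n x)%:E = \int[mu]_x ((h n x)%:E * (rho x)%:E))%E.
  by under eq_fun do rewrite hE.
pose A y := h n @^-1` [set y].
have mA y : measurable (A y) by exact: measurable_funPTI.
have yA0 y x : 0 <= y * \1_(A y) x by exact: nnfun_muleindic_ge0.
transitivity (\int[nu]_x (\sum_(y \in range (h n)) (y * \1_(A y) x)%:E))%E.
  by apply: eq_integral => x _; rewrite [in LHS]fimfunE -fsumEFin.
rewrite ge0_integral_fsum//; last 2 first.
- by move=> y; exact/measurable_EFinP/measurable_funM.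
- by move=> y x _; rewrite lee_fin.
transitivity (\int[mu]_x (\sum_(y \in range (h n))
    (y * \1_(A y) x * rho x)%:E))%E; last first.
  apply: eq_integral => x _; rewrite [in RHS]fimfunE -EFinM.
  by rewrite mulr_fsuml fsumEFin.
rewrite ge0_integral_fsum//; last 2 first.
- by move=> y; apply/measurable_EFinP/measurable_funM => //; exact: measurable_funM.
- by move=> y x _; rewrite lee_fin mulr_ge0.
apply: eq_fsbigr => y; rewrite inE => -[x _ hxy].
have y0 : 0 <= y by rewrite -hxy.
under eq_integral do rewrite EFinM.
rewrite ge0_integralZl ?lee_fin//; last by apply/measurable_EFinP.
rewrite integral_indic// setIT nuE//.
under [RHS]eq_integral do rewrite -mulrA EFinM.
rewrite ge0_integralZl ?lee_fin//.
- rewrite integral_mkcond; congr (_ * _)%E; apply: eq_integral => z _.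
  by rewrite patchE indicE; case: ifP => _; rewrite ?mul1r ?mul0r.
- exact/measurable_EFinP/measurable_funM.
- by move=> z _; rewrite lee_fin mulr_ge0.
Qed.

End density.

Section independence.
Context (R : realType) (d d1 d2 : measure_display) (T : measurableType d)
  (T1 : measurableType d1) (T2 : measurableType d2).

Lemma product_law (mu : {measure set T -> \bar R})
    (m1 : {sigma_finite_measure set T1 -> \bar R})
    (m2 : {sigma_finite_measure set T2 -> \bar R}) (X : T -> T1) (Z : T -> T2) :
  measurable_fun setT X -> measurable_fun setT Z ->
  (forall A B, measurable A -> measurable B ->
    mu (X @^-1` A `&` Z @^-1` B) = m1 A * m2 B)%E ->
  forall C, measurable C -> mu ((fun t => (X t, Z t)) @^-1` C) = (m1 \x m2)%E C.
Proof.
move=> mX mZ XZ C mC; have mXZ := measurable_fun_pair mX mZ.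
apply/esym.
exact: (@product_measure_unique _ _ _ _ _ m1 m2
  (Measure.clone _ _ _ (pushforward mu (fun t => (X t, Z t))) _) XZ).
Qed.

Variables (P : probability T R) (X : T -> T1) (Z : T -> T2).
Hypothesis XZ : independent_rv P X Z.

Lemma ge0_independent_integralM (f : T1 -> R) (h : T2 -> R) :
  measurable_fun setT f -> measurable_fun setT h ->
  (forall x, 0 <= f x) -> (forall x, 0 <= h x) ->
  (\int[P]_t (f (X t) * h (Z t))%:E =
   \int[P]_t (f (X t))%:E * \int[P]_t (h (Z t))%:E)%E.
Proof.
move=> mf mh f0 h0; case: XZ => mX [mZ XZE].
pose X' : {mfun T >-> T1} := HB.pack X (isMeasurableFun.Build _ _ _ _ _ mX).
pose Z' : {mfun T >-> T2} := HB.pack Z (isMeasurableFun.Build _ _ _ _ _ mZ).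
pose D1 := distribution P X'; pose D2 := distribution P Z'.
have pl := product_law (m1 := D1) (m2 := D2) mX mZ XZE.
have mid : measurable_fun [set: T1 * T2] id by exact: measurable_id.
pose F z : \bar R := (f z.1 * h z.2)%:E.
have mF : measurable_fun setT F.
  by apply/measurable_EFinP/measurable_funM; exact: measurableT_comp.
have F0 z : (0 <= F z)%E by rewrite lee_fin mulr_ge0.
have -> := @ge0_eq_law_integral _ _ _ _ _ _ _ P (D1 \x D2)%E _ id
  (measurable_fun_pair mX mZ) mid pl F mF F0.
rewrite fubini_tonelli1//.
under eq_integral => x _.
  rewrite /fubini_F/=; under eq_integral do rewrite /F EFinM/=.
  rewrite ge0_integralZl ?lee_fin//; [|exact/measurable_EFinP|by move=> y _; rewrite lee_fin].
  over.
have mfE : measurable_fun setT (EFin \o f) by exact/measurable_EFinP.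
have mhE : measurable_fun setT (EFin \o h) by exact/measurable_EFinP.
have <- : (\int[D1]_x (EFin \o f) x = \int[P]_t (f (X t))%:E)%E.
  by apply: (ge0_integral_distribution X') => // y; rewrite lee_fin.
have <- : (\int[D2]_x (EFin \o h) x = \int[P]_t (h (Z t))%:E)%E.
  by apply: (ge0_integral_distribution Z') => // y; rewrite lee_fin.
rewrite ge0_integralZr//; first by move=> y _; rewrite lee_fin.
by apply: integral_ge0 => y _; rewrite lee_fin.
Qed.

End independence.

Lemma independent_rv_comp (R : realType) (d d1 d2 d3 d4 : measure_display)
    (T : measurableType d) (T1 : measurableType d1) (T2 : measurableType d2)
    (T3 : measurableType d3) (T4 : measurableType d4) (P : probability T R)
    (X : T -> T1) (Z : T -> T2) (f : T1 -> T3) (h : T2 -> T4) :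
  measurable_fun setT f -> measurable_fun setT h ->
  independent_rv P X Z -> independent_rv P (f \o X) (h \o Z).
Proof.
move=> mf mh [mX [mZ XZ]]; split; first exact: measurableT_comp.
split; first exact: measurableT_comp.
move=> A B mA mB; apply: (XZ (f @^-1` A) (h @^-1` B)).
  by rewrite -[X in measurable X]setTI; exact: mf.
by rewrite -[X in measurable X]setTI; exact: mh.
Qed.

(* Positive and negative parts reduce the signed case to Tonelli. *)
Lemma independent_integralM (R : realType) (d : measure_display)
    (T : measurableType d) (P : probability T R) (X Z : T -> R) :
  independent_rv P X Z ->
  P.-integrable setT (EFin \o X) -> P.-integrable setT (EFin \o Z) ->
  P.-integrable setT (EFin \o (fun t => X t * Z t)) /\
  (\int[P]_t (X t * Z t)%:E = \int[P]_t (X t)%:E * \int[P]_t (Z t)%:E)%E.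
Proof.
move=> XZ iX iZ; case: (XZ) => mX [mZ _].
pose p (x : R) := Num.max x 0; pose q (x : R) := Num.max (- x) 0.
have mp : measurable_fun setT p by exact: measurable_maxr.
have mq : measurable_fun setT q by apply: measurable_maxr.
have p0 x : 0 <= p x by rewrite /p le_max lexx orbT.
have q0 x : 0 <= q x by rewrite /q le_max lexx orbT.
have pq x : x = p x - q x by rewrite /p /q; case: (lerP x 0) => ?; case: lerP => ?; lra.
have pn x : p x <= `|x| by rewrite /p ge_max normr_ge0 ler_norm.
have qn x : q x <= `|x| by rewrite /q ge_max normr_ge0 -normrN ler_norm.
have int (W : T -> R) (s : R -> R) : measurable_fun setT s -> (forall x, 0 <= s x) ->
    (forall x, s x <= `|x|) -> P.-integrable setT (EFin \o W) ->
    P.-integrable setT (EFin \o (s \o W)).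
  move=> ms s0 sn iW; apply: (le_integrable measurableT _ _ iW).
    apply: measurableT_comp => //; apply: measurableT_comp => //.
    by have /measurable_EFinP := measurable_int _ iW.
  by move=> t _; rewrite /= lee_fin ger0_norm.
have prod (s r : R -> R) : measurable_fun setT s -> (forall x, 0 <= s x) ->
    (forall x, s x <= `|x|) -> measurable_fun setT r -> (forall x, 0 <= r x) ->
    (forall x, r x <= `|x|) ->
    P.-integrable setT (EFin \o (fun t => s (X t) * r (Z t))) /\
    (\int[P]_t (s (X t) * r (Z t))%:E =
     (fine (\int[P]_t (s (X t))%:E) * fine (\int[P]_t (r (Z t))%:E))%:E)%E.
  move=> ms s0 sn mr r0 rn.
  have := ge0_independent_integralM XZ ms mr s0 r0.
  have f1 := integrable_fin_num measurableT (int X s ms s0 sn iX).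
  have f2 := integrable_fin_num measurableT (int Z r mr r0 rn iZ).
  rewrite -(fineK f1) -(fineK f2) -EFinM => E; split; last exact: E.
  apply/integrableP; split.
    by apply/measurable_EFinP/measurable_funM; exact: measurableT_comp.
  under eq_integral do rewrite /= ger0_norm ?mulr_ge0//.
  by rewrite E ltry.
have [iA eA] := prod p p mp p0 pn mp p0 pn.
have [iB eB] := prod p q mp p0 pn mq q0 qn.
have [iC eC] := prod q p mq q0 qn mp p0 pn.
have [iD eD] := prod q q mq q0 qn mq q0 qn.
have dec (W : T -> R) : P.-integrable setT (EFin \o W) ->
    (\int[P]_t (W t)%:E = (fine (\int[P]_t (p (W t))%:E) -
                          fine (\int[P]_t (q (W t))%:E))%:E)%E.
  move=> iW; have ip := int W p mp p0 pn iW; have iq := int W q mq q0 qn iW.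
  rewrite EFinB !fineK; [|exact: (integrable_fin_num measurableT iq)|
    exact: (integrable_fin_num measurableT ip)].
  by rewrite -integralB//; apply: eq_integral => t _; rewrite /= -EFinB -pq.
have iAB : P.-integrable setT (EFin \o (fun t => p (X t) * p (Z t) - p (X t) * q (Z t))).
  exact: (integrableB _ iA iB).
have iCD : P.-integrable setT (EFin \o (fun t => q (X t) * p (Z t) - q (X t) * q (Z t))).
  exact: (integrableB _ iC iD).
have XZE : (fun t => X t * Z t) = (fun t => (p (X t) * p (Z t) - p (X t) * q (Z t)) -
    (q (X t) * p (Z t) - q (X t) * q (Z t))).
  by apply/funext => t; rewrite {1}(pq (X t)) {1}(pq (Z t)); ring.
split; first by rewrite XZE; exact: (integrableB _ iAB iCD).
transitivity (\int[P]_t ((p (X t) * p (Z t) - p (X t) * q (Z t)) -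
    (q (X t) * p (Z t) - q (X t) * q (Z t)))%:E)%E.
  by apply: eq_integral => t _; rewrite -[in RHS](congr1 (@^~ t) XZE).
under eq_integral do rewrite EFinB.
rewrite integralB//.
under eq_integral do rewrite EFinB.
rewrite [X in (_ - X)%E](_ : _ = (\int[P]_t ((q (X t) * p (Z t))%:E - (q (X t) * q (Z t))%:E))%E)//.
rewrite !integralB// eA eB eC eD (dec X)// (dec Z)// -!EFinB -EFinM.
by congr EFin; ring.
Qed.

Lemma lebesgue_measure_shift (R : realType) (a : R) (A : set R) : measurable A ->
  lebesgue_measure ((fun x => x + a) @^-1` A) = lebesgue_measure A :> \bar R.
Proof.
move=> mA.
have ma : measurable_fun [set: R] (fun x => x + a) by exact: measurable_funD.
pose f : measurableTypeR R -> measurableTypeR R := fun x => x + a.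
have H (mf : measurable_fun setT f) := @lebesgue_measure_unique R
  (measure_function_pushforward__canonical__measure_function_Measure lebesgue_measure mf).
apply/esym; apply: (H ma) => //.
move=> _ [[b c]/= _ <-]; rewrite /pushforward.
have -> : (fun x => x + a) @^-1` [set` `]b, c]] = [set` `]b - a, c - a]].
  by apply/seteqP; split=> x /=; rewrite !in_itv/= ltrBlDr lerBrDr.
rewrite !lebesgue_measure_itv/= !lte_fin ltrD2r.
by case: ifP => // _; rewrite -!EFinD; congr EFin; ring.
Qed.

Lemma normal_pdf_expR (R : realType) (m s x : R) : s != 0 ->
  normal_pdf m s x = normal_peak s * expR (- (x - m) ^+ 2 / (s ^+ 2 *+ 2)).
Proof. by move=> s0; rewrite normal_pdfE. Qed.

Lemma normal_pdf_shift (R : realType) (m s a x : R) : s != 0 ->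
  normal_pdf (m + a) s (x + a) = normal_pdf m s x.
Proof.
move=> s0; rewrite !normal_pdf_expR//.
by have -> : x + a - (m + a) = x - m by ring.
Qed.

Lemma normal_prob_shift (R : realType) (m s a : R) (A : set R) :
  s != 0 -> measurable A ->
  normal_prob m s ((fun x => x + a) @^-1` A) = normal_prob (m + a) s A.
Proof.
move=> s0 mA; rewrite /normal_prob.
have ma : measurable_fun [set: R] (fun x => x + a) by exact: measurable_funD.
pose f : R -> \bar R := EFin \o normal_pdf (m + a) s.
have mf : measurable_fun [set: R] f.
  by apply/measurable_EFinP; exact: measurable_normal_pdf.
pose F : R -> \bar R := f \_ A.
have mF : measurable_fun setT F.
  by apply/(measurable_restrictT f mA); exact: measurable_funTS.
have F0 y : (0 <= F y)%E.
  by apply: erestrict_ge0 => z _; rewrite lee_fin normal_pdf_ge0.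
rewrite [RHS]integral_mkcond.
rewrite -(@ge0_eq_law_integral _ _ _ _ _ _ _ lebesgue_measure lebesgue_measure _ id
  ma (@measurable_id _ _ _) (@lebesgue_measure_shift R a) F mF F0).
rewrite [LHS]integral_mkcond; apply: eq_integral => x _; rewrite /F !patchE.
rewrite (_ : (x \in _) = (x + a \in A)); last by apply/idP/idP; rewrite !inE.
by case: ifP => // _; rewrite /f /= normal_pdf_shift.
Qed.

Lemma eq_gauss1 (R : realType) (m m' v v' : R) (A : set R) :
  m = m' -> v = v' -> gauss1 m v A = gauss1 m' v' A.
Proof. by move=> -> ->. Qed.

Lemma gauss1_shift (R : realType) (m v a : R) (A : set R) : 0 <= v -> measurable A ->
  gauss1 m v ((fun x => x + a) @^-1` A) = gauss1 (m + a) v A.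
Proof.
move=> v0 mA; rewrite /gauss1; have [_|vn0] := eqVneq v 0.
  by rewrite !diracE; congr (nat_of_bool _)%:R%:E; apply/idP/idP; rewrite !inE.
by rewrite normal_prob_shift// gt_eqF// sqrtr_gt0 lt_neqAle eq_sym vn0.
Qed.

(* Completing the square in [a]. *)
Lemma normal_pdf_conv (R : realType) (m1 m2 s1 s2 a y : R) :
  0 < s1 -> 0 < s2 ->
  normal_pdf (m2 + a) s2 y * normal_pdf m1 s1 a =
  normal_pdf (m1 + m2) (Num.sqrt (s1 ^+ 2 + s2 ^+ 2)) y *
  normal_pdf ((s2 ^+ 2 * m1 + s1 ^+ 2 * (y - m2)) / (s1 ^+ 2 + s2 ^+ 2))
    (s1 * s2 / Num.sqrt (s1 ^+ 2 + s2 ^+ 2)) a.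
Proof.
move=> s1p s2p; set s := Num.sqrt _.
have ssp : 0 < s1 ^+ 2 + s2 ^+ 2 by rewrite addr_gt0// exprn_gt0.
have sE : s ^+ 2 = s1 ^+ 2 + s2 ^+ 2 by rewrite sqr_sqrtr// ltW.
have s0 : 0 < s by rewrite sqrtr_gt0.
have [s1w s2w sw] := And3 (ltW s1p) (ltW s2p) (ltW s0).
rewrite !normal_pdf_expR ?gt_eqF ?divr_gt0 ?mulr_gt0//.
rewrite mulrACA [RHS]mulrACA; congr (_ * _).
  rewrite /normal_peak -!invfM -!sqrtrM ?mulrn_wge0 ?mulr_ge0 ?sqr_ge0 ?pi_ge0//.
  congr ((Num.sqrt _)^-1); rewrite !exprMn exprVn.
  field.
  by rewrite gt_eqF.
rewrite -!expRD; f_equal; rewrite !exprMn exprVn sE; field.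
by rewrite ?gt_eqF ?mulr_gt0 ?exprn_gt0.
Qed.

Lemma gauss1_probability (R : realType) (m v : R) :
  {G : probability (measurableTypeR R) R | forall A, G A = gauss1 m v A}.
Proof.
rewrite /gauss1; have [_|_] := eqVneq v 0.
  by exists (dirac (m : measurableTypeR R)).
by exists (normal_prob m (Num.sqrt v)).
Qed.

Lemma normal_prob_conv (R : realType) (m1 m2 s1 s2 : R) (A : set R) :
  0 < s1 -> 0 < s2 -> measurable A ->
  (\int[normal_prob m1 s1]_x normal_prob (m2 + x) s2 A =
   normal_prob (m1 + m2) (Num.sqrt (s1 ^+ 2 + s2 ^+ 2)) A)%E.
Proof.
move=> s1p s2p mA; pose mu := @lebesgue_measure R.
pose h (z : measurableTypeR R * measurableTypeR R) : \bar R :=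
  (normal_pdf (m2 + z.1) s2 z.2 * \1_A z.2)%:E.
have mh : measurable_fun setT h.
  apply/measurable_EFinP/measurable_funM; last first.
    by apply: measurableT_comp => //; exact: measurable_indic.
  rewrite (_ : (fun z => _) = (fun z : R * R => normal_pdf 0 s2 (z.2 - (m2 + z.1)))).
    apply: measurableT_comp; first exact: measurable_normal_pdf.
    by apply: measurable_funB => //; exact: measurable_funD.
  apply/funext => z; rewrite -(@normal_pdf_shift _ 0 _ (m2 + z.1)) ?gt_eqF//.
  by rewrite add0r subrK.
have h0 z : (0 <= h z)%E by rewrite lee_fin mulr_ge0// normal_pdf_ge0.
have mp : measurable_fun setT (normal_pdf m1 s1) by exact: measurable_normal_pdf.
have p0 x : (0 <= (normal_pdf m1 s1 x)%:E)%E by rewrite lee_fin normal_pdf_ge0.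
have hE x : normal_prob (m2 + x) s2 A = (\int[mu]_y h (x, y))%E.
  rewrite /normal_prob integral_mkcond; apply: eq_integral => y _.
  by rewrite patchE /h/= indicE; case: ifP => _; rewrite ?mulr1 ?mulr0.
under eq_integral do rewrite hE.
rewrite (@ge0_integral_density _ _ _ mu _ (normal_pdf m1 s1))//; first last.
- by move=> x; exact: integral_ge0.
- exact: measurable_fun_fubini_tonelli_F.
pose f z := (h z * (normal_pdf m1 s1 z.1)%:E)%E.
have mf : measurable_fun setT f.
  by apply: emeasurable_funM => //; apply/measurable_EFinP; exact: measurableT_comp.
have f0 z : (0 <= f z)%E by rewrite mule_ge0.
transitivity (\int[mu]_x \int[mu]_y f (x, y))%E.
  apply: eq_integral => x _; rewrite /f/= ge0_integralZr//.
  exact: measurableT_comp mh _.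
rewrite fubini_tonelli// /normal_prob [RHS]integral_mkcond; apply: eq_integral => y _.
rewrite patchE; set s := Num.sqrt _; set p := normal_pdf _ s y.
transitivity (\int[mu]_x ((p * \1_A y)%:E * (normal_pdf
   ((s2 ^+ 2 * m1 + s1 ^+ 2 * (y - m2)) / (s1 ^+ 2 + s2 ^+ 2))
   (s1 * s2 / s) x)%:E))%E.
  apply: eq_integral => x _; rewrite /f /h -!EFinM /=; congr EFin.
  by rewrite mulrAC normal_pdf_conv// mulrAC.
rewrite ge0_integralZl//.
- rewrite integral_normal_pdf mule1 indicE.
  by case: ifP => _; rewrite ?mulr1 ?mulr0.
- by apply/measurable_EFinP; exact: measurable_normal_pdf.
- by move=> x _; rewrite lee_fin normal_pdf_ge0.
- by rewrite lee_fin mulr_ge0// normal_pdf_ge0.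
Qed.

Lemma gauss1_conv (R : realType) (d : measure_display) (T : measurableType d)
    (mu : {measure set T -> \bar R}) (X Z : T -> R) (m1 m2 v1 v2 : R) :
  measurable_fun setT X -> measurable_fun setT Z -> 0 <= v1 -> 0 <= v2 ->
  (forall A B, measurable A -> measurable B ->
    mu (X @^-1` A `&` Z @^-1` B) = gauss1 m1 v1 A * gauss1 m2 v2 B)%E ->
  forall A, measurable A ->
    mu ((fun t => X t + Z t) @^-1` A) = gauss1 (m1 + m2) (v1 + v2) A.
Proof.
move=> mX mZ v10 v20 XZ A mA.
have [G1 G1E] := gauss1_probability m1 v1; have [G2 G2E] := gauss1_probability m2 v2.
pose C := [set z : measurableTypeR R * measurableTypeR R | A (z.1 + z.2)].
have mC : measurable C.
  rewrite -[C]setTI; apply: (@measurable_funD _ _ _ _ fst snd) => //.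
have -> : mu ((fun t => X t + Z t) @^-1` A) = (G1 \x G2)%E C.
  apply: (@product_law _ _ _ _ _ (measurableTypeR R) (measurableTypeR R)
    mu G1 G2 X Z mX mZ) => // E F mE mF.
  by rewrite XZ// -G1E -G2E.
have xC x : G2 (xsection C x) = gauss1 (m2 + x) v2 A.
  rewrite -gauss1_shift// -G2E; congr (G2 _).
  by apply/seteqP; split=> y; rewrite /xsection/= inE/= addrC.
have mG : measurable_fun [set: R] (fun x => gauss1 (m2 + x) v2 A).
  rewrite -(funext xC); exact: measurable_fun_xsection.
rewrite /product_measure1/=.
under eq_integral do rewrite /= xC.
have [v1E|v1n0] := eqVneq v1 0.
  rewrite (eq_measure_integral (dirac (m1 : measurableTypeR R))); last first.
    by move=> B mB _; apply: etrans (G1E B) _; rewrite /gauss1 v1E eqxx.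
  by rewrite integral_dirac// diracT mul1e v1E add0r addrC.
have v1p : 0 < v1 by rewrite lt_neqAle eq_sym v1n0.
have [v2E|v2n0] := eqVneq v2 0.
  have mS : measurable ((fun x => x + m2) @^-1` A).
    by rewrite -[X in measurable X]setTI; exact: measurable_funD.
  have -> : gauss1 (m1 + m2) (v1 + v2) A = G1 ((fun x => x + m2) @^-1` A).
    by rewrite v2E addr0 G1E gauss1_shift.
  rewrite -[in RHS](setIT (_ @^-1` A)) -integral_indic//.
  apply: eq_integral => x _; rewrite v2E /gauss1 eqxx diracE indicE.
  by congr (nat_of_bool _)%:R%:E; apply/idP/idP; rewrite !inE/= addrC.
have v2p : 0 < v2 by rewrite lt_neqAle eq_sym v2n0.
rewrite (eq_measure_integral (normal_prob m1 (Num.sqrt v1))); last first.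
  by move=> B mB _; apply: etrans (G1E B) _; rewrite /gauss1 (negbTE v1n0).
under eq_integral do rewrite /gauss1 (negbTE v2n0).
rewrite normal_prob_conv ?sqrtr_gt0// !sqr_sqrtr//.
by rewrite /gauss1 gt_eqF// addr_gt0.
Qed.

Lemma independent_rv_box (R : realType) (d : measure_display) (T : measurableType d)
    (P : probability T R) (n : nat) (Z : T -> R) (X : T -> n.-tuple R) :
  measurable_fun setT Z -> measurable_fun setT X ->
  (forall A (B : 'I_n -> set R), measurable A -> (forall i, measurable (B i)) ->
    P (Z @^-1` A `&` X @^-1` box B) = P (Z @^-1` A) * P (X @^-1` box B))%E ->
  independent_rv P Z X.
Proof.
move=> mZ mX H; split => //; split => // A B mA mB.
have mZA : measurable (Z @^-1` A) by rewrite -[X in measurable X]setTI; exact: mZ.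
have r0 : 0 <= fine (P (Z @^-1` A)) by exact: fine_ge0.
have rE : (fine (P (Z @^-1` A)))%:E = P (Z @^-1` A) by rewrite fineK// fin_num_measure.
pose m1 (mX : measurable_fun setT X) :=
  measure_function_pushforward__canonical__measure_function_Measure (mrestr P mZA) mX.
pose m2 (mX : measurable_fun setT X) := mscale (NngNum r0)
  (measure_function_pushforward__canonical__measure_function_Measure P mX).
have := @tuple_measure_unique R n (m1 mX) (m2 mX) _ _ B mB.
rewrite /m1 /m2 /= /mscale /pushforward /mrestr/= rE => U; rewrite setIC; apply: U.
- rewrite preimage_setT setTI.
  by apply: le_lt_trans (probability_le1 P mZA) _; rewrite ltry.
- by move=> C mC; rewrite setIC H.
Qed.

Lemma gauss_independent_rv (R : realType) (d : measure_display)
    (T : measurableType d) (P : probability T R) (n : nat) (Z : T -> R)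
    (X : T -> n.-tuple R) (m0 v0 : R) (m v : 'I_n -> R) :
  measurable_fun setT Z -> measurable_fun setT X ->
  0 <= v0 -> (forall i, 0 <= v i) ->
  (forall (c : R) (u : 'I_n -> R) (A : set R), measurable A ->
    P ((fun t => c * Z t + \sum_i u i * tnth (X t) i) @^-1` A) =
    gauss1 (c * m0 + \sum_i u i * m i) (c ^+ 2 * v0 + \sum_i u i ^+ 2 * v i) A) ->
  independent_rv P Z X.
Proof.
move=> mZ mX v00 v_ge0 law; apply: independent_rv_box => // A B mA mB.
have mXi i : measurable_fun setT (fun t => tnth (X t) i).
  exact: (measurableT_comp (measurable_tnth i) mX).
pose F (i : 'I_n.+1) (t : T) : R := tnth (cons_tuple (Z t) (X t)) i.
pose F' (i : 'I_n.+1) (t : T * T) : R := tnth (cons_tuple (Z t.1) (X t.2)) i.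
have F0 t : F ord0 t = Z t by rewrite /F tnth0.
have F'0 t : F' ord0 t = Z t.1 by rewrite /F' tnth0.
have FS i t : F (lift ord0 i) t = tnth (X t) i by rewrite /F tnthS.
have F'S i t : F' (lift ord0 i) t = tnth (X t.2) i by rewrite /F' tnthS.
have mF i : measurable_fun setT (F i).
  case: (unliftP ord0 i) => [j ->|->].
    by rewrite (_ : F _ = fun t => tnth (X t) j)//; apply/funext => t.
  by rewrite (_ : F _ = Z)//; apply/funext => t.
have mF' i : measurable_fun setT (F' i).
  case: (unliftP ord0 i) => [j ->|->].
    rewrite (_ : F' _ = (fun t => tnth (X t) j) \o snd); last by apply/funext => t /=.
    exact: measurableT_comp.
  rewrite (_ : F' _ = Z \o fst); last by apply/funext => t /=.
  exact: measurableT_comp.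
pose C i : set R := if unlift ord0 i is Some j then B j else A.
have C0 : C ord0 = A by rewrite /C unlift_none.
have CS i : C (lift ord0 i) = B i by rewrite /C liftK.
have mC i : measurable (C i) by rewrite /C; case: unliftP.
have PT : (P [set: T] < +oo)%E by rewrite probability_setT ltry.
have PPT : ((P \x P)%E [set: T * T] < +oo)%E.
  rewrite -setXTT product_measure1E// [X in (X * _)%E]probability_setT mul1e.
  by rewrite [X in (X < _)%E]probability_setT ltry.
have := @cramer_wold R _ _ _ _ P (P \x P)%E 'I_n.+1 F F' PT PPT mF mF' _ C mC.
have allC (U : Type) (G : 'I_n.+1 -> U -> R) t : (forall i, C i (G i t)) <->
    A (G ord0 t) /\ forall j, B j (G (lift ord0 j) t).
  split=> [H|[HA HB] i]; first by split=> [|j]; [rewrite -C0|rewrite -CS]; exact: H.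
  by case: (unliftP ord0 i) => [j ->|->]; rewrite ?CS ?C0.
have -> : [set t | forall i, C i (F i t)] = Z @^-1` A `&` X @^-1` box B.
  apply/seteqP; split=> t /=.
    by move=> /allC[]; rewrite F0 => ZA XB; split=> // j; have := XB j; rewrite FS.
  by move=> [ZA XB]; apply/allC; rewrite F0; split=> // j; rewrite FS; exact: XB.
have -> : [set t | forall i, C i (F' i t)] = (Z @^-1` A) `*` (X @^-1` box B).
  apply/seteqP; split=> t /=.
    by move=> /allC[]; rewrite F'0 => ZA XB; split=> // j; have := XB j; rewrite F'S.
  by move=> [ZA XB]; apply/allC; rewrite F'0; split=> // j; rewrite F'S; exact: XB.
have mZA : measurable (Z @^-1` A) by rewrite -[X in measurable X]setTI; exact: mZ.
have mXB : measurable (X @^-1` box B).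
  by rewrite -[X in measurable X]setTI; apply: mX => //; exact: measurable_box.
move=> U; apply: etrans (U _) _; last exact: product_measure1E.
move=> {U} u D mD.
pose c := u ord0; pose u' i := u (lift ord0 i).
have -> : lincomb F u = (fun t => c * Z t + \sum_i u' i * tnth (X t) i).
  apply/funext => t; rewrite /lincomb big_ord_recl F0.
  by under eq_bigr do rewrite FS.
have -> : lincomb F' u = (fun t => (fun t => c * Z t) t.1 +
    (fun t => \sum_i u' i * tnth (X t) i) t.2).
  apply/funext => t; rewrite /lincomb big_ord_recl F'0.
  by under eq_bigr do rewrite F'S.
have mS : measurable_fun setT (fun t => \sum_i u' i * tnth (X t) i).
  by apply: measurable_sum => i; exact: measurable_funM.
have mcZ : measurable_fun setT (fun t => c * Z t) by exact: measurable_funM.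
have vu0 : 0 <= \sum_i u' i ^+ 2 * v i.
  by apply: sumr_ge0 => i _; rewrite mulr_ge0// sqr_ge0.
have lawZ E : measurable E ->
    P ((fun t => c * Z t) @^-1` E) = gauss1 (c * m0) (c ^+ 2 * v0) E.
  have -> : (fun t => c * Z t) = (fun t => c * Z t + \sum_i 0 * tnth (X t) i).
    by apply/funext => t; rewrite big1 ?addr0// => i _; rewrite mul0r.
  move=> mE; apply: etrans (law c (fun=> 0) E mE) _.
  by rewrite !big1 ?addr0// => i _; rewrite ?expr0n mul0r.
have lawX E : measurable E -> P ((fun t => \sum_i u' i * tnth (X t) i) @^-1` E) =
    gauss1 (\sum_i u' i * m i) (\sum_i u' i ^+ 2 * v i) E.
  have -> : (fun t => \sum_i u' i * tnth (X t) i) =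
      (fun t => 0 * Z t + \sum_i u' i * tnth (X t) i).
    by apply/funext => t; rewrite mul0r add0r.
  move=> mE; apply: etrans (law 0 u' E mE) _.
  by rewrite expr0n !mul0r !add0r.
apply: etrans (law c u' D mD) _; apply/esym.
apply: (@gauss1_conv _ _ _ _ ((fun t => c * Z t) \o fst)
  ((fun t => \sum_i u' i * tnth (X t) i) \o snd)) => //.
- exact: measurableT_comp.
- exact: measurableT_comp.
- by rewrite mulr_ge0// sqr_ge0.
- move=> E G mE mG; rewrite -lawZ// -lawX// -product_measure1E//.
  + by rewrite -[X in measurable X]setTI; exact: mcZ.
  + by rewrite -[X in measurable X]setTI; exact: mS.
Qed.

Section gaussian_vec.
Context (R : realType) (d : measure_display) (T : measurableType d)
  (P : probability T R) (n : nat) (X : T -> n.-tuple R) (theta : n.-tuple R) (v : R).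
Hypothesis v_ge0 : 0 <= v.
Hypothesis gX : gaussian_vec P X theta v.

Lemma gaussian_vec_measurable_tnth i : measurable_fun setT (fun t => tnth (X t) i).
Proof. by case: gX => mX _; exact: mX. Qed.

Lemma gaussian_vec_measurable : measurable_fun setT X.
Proof. by apply/measurable_fun_tnthP => i; exact: gaussian_vec_measurable_tnth. Qed.

Lemma gaussian_vec_law (u : 'I_n -> R) (A : set R) : measurable A ->
  P ((fun t => \sum_i u i * tnth (X t) i) @^-1` A) =
  gauss1 (\sum_i u i * tnth theta i) (\sum_i u i ^+ 2 * v) A.
Proof.
move=> mA; case: gX => _ /(_ u A mA) H; apply: etrans H _; apply: eq_gauss1; first by [].
apply: eq_bigr => i _; rewrite (bigD1 i)//= eqxx big1 ?addr0 ?expr2//.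
by move=> j ji; rewrite eq_sym (negbTE ji) mulr0.
Qed.

Lemma gaussian_vec_law1 i (A : set R) : measurable A ->
  P ((fun t => tnth (X t) i) @^-1` A) = gauss1 (tnth theta i) v A.
Proof.
move=> mA.
have S1 (f : 'I_n -> R) : \sum_j (j == i)%:R * f j = f i.
  rewrite (bigD1 i)//= eqxx mul1r big1 ?addr0// => j ji.
  by rewrite (negbTE ji) mul0r.
have -> : (fun t => tnth (X t) i) = (fun t => \sum_j (j == i)%:R * tnth (X t) j).
  by apply/funext => t; rewrite S1.
apply: etrans (gaussian_vec_law _ mA) _; rewrite S1; apply: eq_gauss1; first by [].
rewrite -[RHS](S1 (fun=> v)); apply: eq_bigr => j _.
by case: eqP; rewrite ?expr1n ?expr0n.
Qed.

Lemma gaussian_vec_independent (k : 'I_n) :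
  independent_rv P (fun t => tnth (X t) k)
    (fun t => [tuple if (i < k)%N then tnth (X t) i else 0 | i < n]).
Proof.
apply: (@gauss_independent_rv _ _ _ _ _ _ _ (tnth theta k) v
  (fun i => if (i < k)%N then tnth theta i else 0)
  (fun i => if (i < k)%N then v else 0)) => //.
- exact: gaussian_vec_measurable_tnth.
- apply/measurable_fun_tnthP => i.
  rewrite (_ : _ \o _ = fun t => if (i < k)%N then tnth (X t) i else 0); last first.
    by apply/funext => t /=; rewrite tnth_mktuple.
  by case: (i < k)%N; [exact: gaussian_vec_measurable_tnth|].
- by move=> i; case: ifP.
- move=> c u A mA.
  pose u' (i : 'I_n) := if (i < k)%N then u i else if i == k then c else 0.
  have split_sum (f : 'I_n -> R) (g : R -> R) : g 0 = 0 ->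
      \sum_i g (u' i) * f i = g c * f k + \sum_i g (u i) * (if (i < k)%N then f i else 0).
    move=> g0; rewrite (bigD1 k)//= /u' ltnn eqxx; congr (_ + _).
    rewrite [RHS](bigD1 k)//= ltnn mulr0 add0r; apply: eq_bigr => i ik.
    by case: ifP => _ //; rewrite (negbTE ik) g0 mul0r mulr0.
  have -> : (fun t => c * tnth (X t) k + \sum_i u i *
      tnth [tuple if (i < k)%N then tnth (X t) i else 0 | i < n] i) =
      (fun t => \sum_i u' i * tnth (X t) i).
    apply/funext => t; rewrite (split_sum _ id)//=; congr (_ + _).
    by apply: eq_bigr => i _; rewrite tnth_mktuple.
  apply: etrans (gaussian_vec_law u' mA) _.
  apply: eq_gauss1; first exact: (split_sum _ id).
  by apply: (split_sum (fun=> v) (fun x => x ^+ 2)); rewrite expr0n.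
Qed.

Lemma gaussian_vec_integralM (f : 'I_n -> R -> R) (k : 'I_n) :
  (forall i, measurable_fun setT (f i)) -> (forall i x, 0 <= f i x) ->
  (\int[P]_t (\prod_(i < n | (i < k.+1)%N) f i (tnth (X t) i))%:E =
   \int[P]_t (f k (tnth (X t) k))%:E *
   \int[P]_t (\prod_(i < n | (i < k)%N) f i (tnth (X t) i))%:E)%E.
Proof.
move=> mf f0.
pose F (x : n.-tuple R) := \prod_(i < n | (i < k)%N) f i (tnth x i).
have mF : measurable_fun setT F.
  rewrite /F; under eq_fun do rewrite big_mkcond.
  apply: measurable_prod => i _; case: (i < k)%N => //.
  by apply: measurableT_comp => //; exact: measurable_tnth.
have F0 x : 0 <= F x by apply: prodr_ge0 => i _.
have FE t : F [tuple if (i < k)%N then tnth (X t) i else 0 | i < n] =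
    \prod_(i < n | (i < k)%N) f i (tnth (X t) i).
  by apply: eq_bigr => i ik; rewrite tnth_mktuple ik.
have := ge0_independent_integralM (gaussian_vec_independent k) (mf k) mF (f0 k) F0.
under eq_integral do rewrite FE.
under [in X in _ = (_ * X)%E -> _]eq_integral do rewrite FE.
move=> <-; apply: eq_integral => t _; congr EFin.
rewrite (bigD1 k)//=; congr (_ * _); apply: eq_bigl => i.
by rewrite ltnS ltn_neqAle andbC.
Qed.

End gaussian_vec.

Lemma gaussian_vec_prod_eq (R : realType) (d d' : measure_display)
    (T : measurableType d) (T' : measurableType d') (P : probability T R)
    (P' : probability T' R) (n : nat) (X : T -> n.-tuple R) (X' : T' -> n.-tuple R)
    (theta theta' : n.-tuple R) (v v' : R) (f f' : 'I_n -> R -> R) :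
  0 <= v -> 0 <= v' -> gaussian_vec P X theta v -> gaussian_vec P' X' theta' v' ->
  (forall i, measurable_fun setT (f i)) -> (forall i x, 0 <= f i x) ->
  (forall i, measurable_fun setT (f' i)) -> (forall i x, 0 <= f' i x) ->
  (forall i, \int[P]_t (f i (tnth (X t) i))%:E =
             \int[P']_t (f' i (tnth (X' t) i))%:E)%E ->
  (\int[P]_t (\prod_i f i (tnth (X t) i))%:E =
   \int[P']_t (\prod_i f' i (tnth (X' t) i))%:E)%E.
Proof.
move=> v0 v0' gX gX' mf f0 mf' f0' ff'.
suff H k : (k <= n)%N ->
    (\int[P]_t (\prod_(i < n | (i < k)%N) f i (tnth (X t) i))%:E =
     \int[P']_t (\prod_(i < n | (i < k)%N) f' i (tnth (X' t) i))%:E)%E.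
  have := H n (leqnn n).
  under eq_integral do under eq_bigl do rewrite ltn_ord.
  by under [in X in _ = X -> _]eq_integral do under eq_bigl do rewrite ltn_ord.
elim: k => [_|k IH kn].
  rewrite (eq_integral (cst 1%E)); last by move=> t _; rewrite big_pred0.
  rewrite [RHS](eq_integral (cst 1%E)); last by move=> t _; rewrite big_pred0.
  rewrite !integral_cst//; congr (_ * _)%E.
  by rewrite [LHS]probability_setT [RHS]probability_setT.
rewrite (gaussian_vec_integralM v0 gX (Ordinal kn))//.
by rewrite (gaussian_vec_integralM v0' gX' (Ordinal kn))// ff' IH// ltnW.
Qed.

(* [mrho] and [rho_ge0] are arguments only so that the measure structure can be
   inferred. *)
Definition weighted_measure (R : realType) (d : measure_display)
    (T : measurableType d) (mu : {measure set T -> \bar R}) (rho : T -> R)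
    (mrho : measurable_fun setT rho) (rho_ge0 : forall x, 0 <= rho x) :
    set T -> \bar R :=
  fun A => (\int[mu]_(x in A) (rho x)%:E)%E.

Section weighted_measure.
Context (R : realType) (d : measure_display) (T : measurableType d)
  (mu : {measure set T -> \bar R}) (rho : T -> R)
  (mrho : measurable_fun setT rho) (rho_ge0 : forall x, 0 <= rho x).

Local Notation nu := (weighted_measure mu mrho rho_ge0).

Let nu0 : nu set0 = 0%E.
Proof. by rewrite /weighted_measure integral_set0. Qed.

Let nu_ge0 A : (0 <= nu A)%E.
Proof. by apply: integral_ge0 => x _; rewrite lee_fin. Qed.

Let nu_sigma_additive : semi_sigma_additive nu.
Proof.
move=> F mF tF mUF; rewrite /weighted_measure ge0_integral_bigcup//.
- by apply: is_cvg_ereal_nneg_natsum_cond => n _ _; exact: nu_ge0.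
- by apply/measurable_funTS/measurable_EFinP.
- by move=> x _; rewrite lee_fin.
Qed.

HB.instance Definition _ := isMeasure.Build _ _ _ nu nu0 nu_ge0 nu_sigma_additive.

End weighted_measure.

Lemma ge0_integral_gauss1 (R : realType) (d : measure_display)
    (T : measurableType d) (P : probability T R) (X : T -> R) (m v : R) (f : R -> R) :
  0 < v -> measurable_fun setT X ->
  (forall A, measurable A -> P (X @^-1` A) = gauss1 m v A) ->
  measurable_fun setT f -> (forall x, 0 <= f x) ->
  (\int[P]_t (f (X t))%:E =
   \int[lebesgue_measure]_x (f x * normal_pdf m (Num.sqrt v) x)%:E)%E.
Proof.
move=> v0 mX lawX mf f0.
have mfE : measurable_fun setT (EFin \o f) by exact/measurable_EFinP.
have mid : measurable_fun setT (id : measurableTypeR R -> measurableTypeR R).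
  exact: measurable_id.
have law A : measurable A -> P (X @^-1` A) = normal_prob m (Num.sqrt v) (id @^-1` A).
  by move=> mA; apply: etrans (lawX A mA) _; rewrite /gauss1 gt_eqF.
have E := @ge0_eq_law_integral R _ _ _ _ _ (measurableTypeR R) P
  (normal_prob m (Num.sqrt v)) X id mX mid law (EFin \o f) mfE.
apply: etrans (E _) _; first by move=> x; rewrite lee_fin.
apply: etrans (@ge0_integral_density _ _ _ lebesgue_measure _
  (normal_pdf m (Num.sqrt v)) _ _ _ (EFin \o f) mfE _) _ => //.
- exact: measurable_normal_pdf.
- by move=> x; exact: normal_pdf_ge0.
Qed.

Section normal_pdf_variance.
Context (R : realType).
Implicit Types m v x : R.

Lemma normal_pdf_gt0 m v x : 0 < v -> 0 < normal_pdf m (Num.sqrt v) x.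
Proof.
move=> v0; have s0 : Num.sqrt v != 0 by rewrite gt_eqF// sqrtr_gt0.
by rewrite normal_pdf_expR// mulr_gt0 ?normal_peak_gt0 ?expR_gt0.
Qed.

Lemma normal_pdf_sqrtE m v x : 0 < v ->
  normal_pdf m (Num.sqrt v) x =
  (Num.sqrt (v * pi *+ 2))^-1 * expR (- (x - m) ^+ 2 / (v *+ 2)).
Proof.
move=> v0; rewrite normal_pdf_expR ?gt_eqF ?sqrtr_gt0//.
by rewrite /normal_peak sqr_sqrtr// ltW.
Qed.

Definition normal_ratio m v0 v x : R :=
  normal_pdf m (Num.sqrt v) x / normal_pdf m (Num.sqrt v0) x.

Lemma measurable_normal_ratio m v0 v : 0 < v0 ->
  measurable_fun setT (normal_ratio m v0 v).
Proof.
move=> v00; apply: measurable_funM; first exact: measurable_normal_pdf.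
apply: (@measurable_comp _ _ _ _ _ _ [set y : R | y != 0]).
- by apply: open_measurable; exact: open_neq.
- by move=> _ [x _ <-] /=; rewrite gt_eqF// normal_pdf_gt0.
- apply: open_continuous_measurable_fun; first exact: open_neq.
  by move=> y; rewrite inE => y0; exact: inv_continuous.
- exact: measurable_normal_pdf.
Qed.

Lemma normal_ratio_ge0 m v0 v x : 0 <= normal_ratio m v0 v x.
Proof. by rewrite divr_ge0 ?normal_pdf_ge0. Qed.

Lemma normal_ratio_le m v0 v s x : 0 < s -> s <= v -> v <= v0 ->
  normal_ratio m v0 v x <= Num.sqrt (v0 * pi *+ 2) / Num.sqrt (s * pi *+ 2).
Proof.
move=> s0 sv vv0.
have v0' : 0 < v by apply: lt_le_trans sv.
have v00 : 0 < v0 by apply: lt_le_trans vv0.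
have pip (w : R) : 0 < w -> 0 < w * pi *+ 2.
  by move=> w0; rewrite pmulrn_lgt0// mulr_gt0// pi_gt0.
rewrite ler_pdivrMr ?normal_pdf_gt0// !normal_pdf_sqrtE//.
have simp (a b c : R) : 0 < a -> a / b * (a^-1 * c) = b^-1 * c.
  by move=> a0; rewrite [a / b]mulrC -mulrA mulVKf// gt_eqF.
rewrite simp ?sqrtr_gt0 ?pip//.
apply: ler_pM; [by rewrite invr_ge0 sqrtr_ge0|exact: expR_ge0| |].
- rewrite lef_pV2 ?posrE ?sqrtr_gt0 ?pip//.
  by rewrite ler_wsqrtr// lerMn2r/= ler_wpM2r// pi_ge0.
- rewrite ler_expR !mulNr lerN2 ler_wpM2l ?sqr_ge0//.
  by rewrite lef_pV2 ?posrE ?pmulrn_lgt0// lerMn2r.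
Qed.

Lemma cvg_normal_ratio m v0 v x (w : nat -> R) : 0 < v -> 0 < v0 ->
  (forall k, 0 < w k) -> w k @[k --> \oo] --> v ->
  normal_ratio m v0 (w k) x @[k --> \oo] --> normal_ratio m v0 v x.
Proof.
move=> vp v0p wp wv; rewrite /normal_ratio; apply: cvgMl.
rewrite normal_pdf_sqrtE//.
under eq_fun do rewrite normal_pdf_sqrtE//.
have w2 : w k *+ 2 @[k --> \oo] --> v *+ 2 by exact: cvgMn.
apply: cvgM.
  apply: cvgV; first by rewrite gt_eqF// sqrtr_gt0 pmulrn_lgt0// mulr_gt0// pi_gt0.
  apply: continuous_cvg; first exact: sqrt_continuous.
  by apply: cvgMn; exact: cvgMl.
apply: continuous_cvg; first exact: continuous_expR.
by apply: cvgMr; apply: cvgV => //; rewrite gt_eqF// pmulrn_lgt0.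
Qed.

End normal_pdf_variance.

Lemma ge0_integral_normal_ratio (R : realType) (d d' : measure_display)
    (T : measurableType d) (T' : measurableType d') (P : probability T R)
    (P' : probability T' R) (X : T -> R) (X' : T' -> R) (m v v0 : R) (f : R -> R) :
  0 < v -> 0 < v0 -> measurable_fun setT X -> measurable_fun setT X' ->
  (forall A, measurable A -> P (X @^-1` A) = gauss1 m v A) ->
  (forall A, measurable A -> P' (X' @^-1` A) = gauss1 m v0 A) ->
  measurable_fun setT f -> (forall x, 0 <= f x) ->
  (\int[P]_t (f (X t))%:E =
   \int[P']_t (f (X' t) * normal_ratio m v0 v (X' t))%:E)%E.
Proof.
move=> vp v0p mX mX' lX lX' mf f0.
rewrite (ge0_integral_gauss1 vp mX lX mf f0).
have mr : measurable_fun setT (fun x => f x * normal_ratio m v0 v x).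
  by apply: measurable_funM => //; exact: measurable_normal_ratio.
have r0 x : 0 <= f x * normal_ratio m v0 v x.
  by rewrite mulr_ge0// normal_ratio_ge0.
rewrite (ge0_integral_gauss1 v0p mX' lX' mr r0).
apply: eq_integral => x _; congr EFin.
by rewrite -mulrA /normal_ratio divfK// gt_eqF// normal_pdf_gt0.
Qed.

Definition vec_ratio (R : realType) (n : nat) (theta : n.-tuple R) (v0 v : R)
    (x : n.-tuple R) : R :=
  \prod_i normal_ratio (tnth theta i) v0 v (tnth x i).

Section vec_ratio.
Context (R : realType) (n : nat) (theta : n.-tuple R).

Lemma measurable_vec_ratio (v0 v : R) : 0 < v0 ->
  measurable_fun setT (vec_ratio theta v0 v).
Proof.
move=> v0p; apply: measurable_prod => i _.
by apply: measurableT_comp; [exact: measurable_normal_ratio|exact: measurable_tnth].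
Qed.

Lemma vec_ratio_ge0 (v0 v : R) x : 0 <= vec_ratio theta v0 v x.
Proof. by apply: prodr_ge0 => i _; exact: normal_ratio_ge0. Qed.

Lemma vec_ratio_le (v0 v s : R) x : 0 < s -> s <= v -> v <= v0 ->
  vec_ratio theta v0 v x <=
  (Num.sqrt (v0 * pi *+ 2) / Num.sqrt (s * pi *+ 2)) ^+ n.
Proof.
move=> s0 sv vv0; rewrite -[n in _ ^+ n]card_ord -prodr_const.
by apply: ler_prod => i _; rewrite normal_ratio_ge0 normal_ratio_le.
Qed.

Lemma cvg_vec_ratio (v0 v : R) x (w : nat -> R) : 0 < v -> 0 < v0 ->
  (forall k, 0 < w k) -> w k @[k --> \oo] --> v ->
  vec_ratio theta v0 (w k) x @[k --> \oo] --> vec_ratio theta v0 v x.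
Proof.
move=> vp v0p wp wv; rewrite /vec_ratio; elim: (index_enum _) => [|i s IH].
  by rewrite big_nil; under eq_fun do rewrite big_nil; exact: cvg_cst.
rewrite big_cons; under eq_fun do rewrite big_cons.
by apply: cvgM => //; exact: cvg_normal_ratio.
Qed.

End vec_ratio.

Lemma ge0_integral_gaussian_vec (R : realType) (d d' : measure_display)
    (T : measurableType d) (T' : measurableType d') (P : probability T R)
    (P' : probability T' R) (n : nat) (X : T -> n.-tuple R) (X' : T' -> n.-tuple R)
    (theta : n.-tuple R) (v v0 : R) (h : n.-tuple R -> R) :
  0 < v -> 0 < v0 -> gaussian_vec P X theta v -> gaussian_vec P' X' theta v0 ->
  measurable_fun setT h -> (forall x, 0 <= h x) ->
  (\int[P]_t (h (X t))%:E = \int[P']_t (h (X' t) * vec_ratio theta v0 v (X' t))%:E)%E.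
Proof.
move=> vp v0p gX gX' mh h0.
have mX := gaussian_vec_measurable gX; have mX' := gaussian_vec_measurable gX'.
have mXi := gaussian_vec_measurable_tnth gX.
have mXi' := gaussian_vec_measurable_tnth gX'.
have mr : measurable_fun setT (vec_ratio theta v0 v \o X').
  by apply: measurableT_comp => //; exact: measurable_vec_ratio.
have r0 t : 0 <= (vec_ratio theta v0 v \o X') t by exact: vec_ratio_ge0.
pose nu := weighted_measure P' mr r0.
have onbox (B : 'I_n -> set R) : (forall i, measurable (B i)) ->
    P (X @^-1` box B) = nu (X' @^-1` box B).
  move=> mB.
  have mbox : measurable (X @^-1` box B).
    by rewrite -[X in measurable X]setTI; apply: mX => //; exact: measurable_box.
  have mbox' : measurable (X' @^-1` box B).
    by rewrite -[X in measurable X]setTI; apply: mX' => //; exact: measurable_box.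
  have prod_indic (x : n.-tuple R) : \prod_i \1_(B i) (tnth x i) = \1_(box B) x :> R.
    have [xB|/existsNP[i nB]] := pselect (box B x).
      by rewrite indicE mem_set// big1// => i _; rewrite indicE mem_set//; exact: xB.
    rewrite indicE memNset; last by move=> /(_ i).
    by rewrite (bigD1 i)//= indicE memNset// mul0r.
  have -> : P (X @^-1` box B) = (\int[P]_t (\prod_i \1_(B i) (tnth (X t) i))%:E)%E.
    rewrite -[X in P X]setIT -integral_indic//.
    by apply: eq_integral => t _; rewrite prod_indic.
  have -> : nu (X' @^-1` box B) = (\int[P']_t (\prod_i (\1_(B i) (tnth (X' t) i) *
      normal_ratio (tnth theta i) v0 v (tnth (X' t) i)))%:E)%E.
    rewrite /nu /weighted_measure integral_mkcond; apply: eq_integral => t _.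
    rewrite big_split/= prod_indic patchE indicE.
    rewrite (_ : (t \in _) = (X' t \in box B)); last by apply/idP/idP; rewrite !inE.
    by case: ifP => _; rewrite ?mul1r ?mul0r.
  apply: (gaussian_vec_prod_eq (ltW vp) (ltW v0p) gX gX'
    (f := fun i => \1_(B i))
    (f' := fun i x => \1_(B i) x * normal_ratio (tnth theta i) v0 v x)) => //.
  - move=> i; apply: measurable_funM => //; exact: measurable_normal_ratio.
  - by move=> i x; rewrite mulr_ge0// normal_ratio_ge0.
  - move=> i; apply: (ge0_integral_normal_ratio vp v0p (mXi i) (mXi' i)
      (gaussian_vec_law1 gX i) (gaussian_vec_law1 gX' i)) => //.
have law B : measurable B -> P (X @^-1` B) = nu (X' @^-1` B).
  move=> mB.
  have := @tuple_measure_unique R n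
    (measure_function_pushforward__canonical__measure_function_Measure P mX)
    (measure_function_pushforward__canonical__measure_function_Measure nu mX') _ _ B mB.
  apply => //.
  by apply: le_lt_trans (probability_le1 P _) _; rewrite ?preimage_setT ?ltry.
have mhE : measurable_fun setT (EFin \o h) by exact/measurable_EFinP.
apply: etrans (ge0_eq_law_integral mX mX' law mhE _) _.
  by move=> x; rewrite lee_fin.
apply: (ge0_integral_density mr r0 (mu := P') (nu := nu)) => //.
- exact: measurableT_comp.
- by move=> t; rewrite lee_fin.
Qed.

Lemma cvg_integral_vec_ratio (R : realType) (d : measure_display)
    (T : measurableType d) (P : probability T R) (n : nat) (X : T -> n.-tuple R)
    (theta : n.-tuple R) (v v0 : R) (h : n.-tuple R -> R) (w : nat -> R) :
  0 < v -> measurable_fun setT X -> measurable_fun setT h ->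
  P.-integrable setT (EFin \o h \o X) ->
  (forall k, v <= w k <= v0) -> w k @[k --> \oo] --> v ->
  (\int[P]_t (h (X t) * vec_ratio theta v0 (w k) (X t))%:E @[k --> \oo] -->
   \int[P]_t (h (X t) * vec_ratio theta v0 v (X t))%:E)%E.
Proof.
move=> vp mX mh iX wv wc.
have v0p : 0 < v0 by have /andP[a b] := wv 0%N; exact: lt_le_trans vp (le_trans a b).
pose C : R := (Num.sqrt (v0 * pi *+ 2) / Num.sqrt (v * pi *+ 2)) ^+ n.
apply: (@dominated_cvg _ _ _ P setT measurableT _ _
  (EFin \o (fun t => C * `|h (X t)|))) => //.
- move=> k; apply/measurable_EFinP/measurable_funM; first exact: measurableT_comp.
  by apply: measurableT_comp => //; exact: measurable_vec_ratio.
- move=> t _; apply: cvg_EFin; first exact: nearW.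
  apply: cvgMr; apply: cvg_vec_ratio => // k.
  by have /andP[a _] := wv k; exact: lt_le_trans a.
- rewrite (_ : _ \o _ = (fun t => C%:E * `|(EFin \o h \o X) t|))%E.
    by apply: integrableZl => //; exact: integrable_abse.
  by apply/funext => t.
- move=> k t _; rewrite /= lee_fin normrM mulrC ler_wpM2r//.
  have /andP[a b] := wv k; rewrite ger0_norm ?vec_ratio_ge0//.
  exact: vec_ratio_le.
Qed.

Lemma integrable_vec_ratio (R : realType) (d : measure_display)
    (T : measurableType d) (P : probability T R) (n : nat) (X : T -> n.-tuple R)
    (theta : n.-tuple R) (v v0 : R) (h : n.-tuple R -> R) :
  0 < v -> v <= v0 -> measurable_fun setT X -> measurable_fun setT h ->
  P.-integrable setT (EFin \o h \o X) ->
  P.-integrable setT (EFin \o (fun t => h (X t) * vec_ratio theta v0 v (X t))).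
Proof.
move=> vp vv0 mX mh iX; have v0p := lt_le_trans vp vv0.
pose C : R := (Num.sqrt (v0 * pi *+ 2) / Num.sqrt (v * pi *+ 2)) ^+ n.
apply: (@le_integrable _ _ _ P setT measurableT _ (fun t => C%:E * (EFin \o h \o X) t)%E).
- apply/measurable_EFinP/measurable_funM; first exact: measurableT_comp.
  by apply: measurableT_comp => //; exact: measurable_vec_ratio.
- have C0 : 0 <= C by rewrite exprn_ge0// divr_ge0.
  move=> t _; rewrite /= lee_fin !normrM mulrC ler_wpM2r//.
  by rewrite !ger0_norm ?vec_ratio_ge0//; exact: vec_ratio_le.
- exact: integrableZl.
Qed.

(* [y exp(-y) <= 1] at [y = (x - m)^2 / (4 v)] trades the quadratic factor for
   a doubling of the variance. *)
Lemma sqr_normal_pdf_le (R : realType) (m v x : R) : 0 < v ->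
  (x - m) ^+ 2 * normal_pdf m (Num.sqrt v) x <=
  4 * v * (Num.sqrt (v *+ 2 * pi *+ 2) / Num.sqrt (v * pi *+ 2)) *
  normal_pdf m (Num.sqrt (v *+ 2)) x.
Proof.
move=> v0; have v20 : 0 < v *+ 2 by rewrite pmulrn_lgt0.
rewrite !normal_pdf_sqrtE//.
set a := Num.sqrt (v *+ 2 * pi *+ 2); set b := Num.sqrt (v * pi *+ 2).
have a0 : a != 0 by rewrite gt_eqF// sqrtr_gt0 pmulrn_lgt0// mulr_gt0// pi_gt0.
have b0 : 0 < b by rewrite sqrtr_gt0 pmulrn_lgt0// mulr_gt0// pi_gt0.
pose y := (x - m) ^+ 2 / (4 * v).
have y4 : (x - m) ^+ 2 = 4 * v * y.
  by rewrite /y mulrC divfK// gt_eqF// mulr_gt0.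
clearbody y.
have -> : - (x - m) ^+ 2 / (v *+ 2) = - y + - y.
  by rewrite y4; field; rewrite gt_eqF.
have -> : - (x - m) ^+ 2 / (v *+ 2 *+ 2) = - y.
  by rewrite y4; field; rewrite gt_eqF.
rewrite y4 expRD.
have -> : 4 * v * (a / b) * (a^-1 * expR (- y)) = 4 * v * (b^-1 * expR (- y)).
  by field; rewrite a0 gt_eqF.
rewrite -!mulrA ler_wpM2l// ler_wpM2l ?(ltW v0)//.
rewrite [y * _]mulrCA ler_wpM2l ?invr_ge0 ?(ltW b0)//.
rewrite mulrA [leRHS](_ : _ = 1 * expR (- y)); last by rewrite mul1r.
rewrite ler_wpM2r ?expR_ge0// expRN ler_pdivrMr ?expR_gt0// mul1r.
by apply: le_trans (expR_ge1Dx y); rewrite lerDr.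
Qed.

Lemma gauss1_integrable_sqr (R : realType) (d : measure_display)
    (T : measurableType d) (P : probability T R) (X : T -> R) (m v : R) :
  0 < v -> measurable_fun setT X ->
  (forall A, measurable A -> P (X @^-1` A) = gauss1 m v A) ->
  P.-integrable setT (EFin \o (fun t => (X t - m) ^+ 2)).
Proof.
move=> v0 mX lX.
have mf : measurable_fun setT (fun x : R => (x - m) ^+ 2).
  by apply: measurable_funX; exact: measurable_funB.
apply/integrableP; split.
  by apply/measurable_EFinP; exact: (measurableT_comp mf).
under eq_integral do rewrite /= ger0_norm ?sqr_ge0//.
rewrite (ge0_integral_gauss1 v0 mX lX mf (fun x => sqr_ge0 _)).
set C := 4 * v * (Num.sqrt (v *+ 2 * pi *+ 2) / Num.sqrt (v * pi *+ 2)).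
have C0 : 0 <= C by rewrite !mulr_ge0 ?invr_ge0 ?sqrtr_ge0 ?ltW.
apply: (@le_lt_trans _ _ (\int[lebesgue_measure]_x
    (C%:E * (normal_pdf m (Num.sqrt (v *+ 2)) x)%:E))%E).
  apply: ge0_le_integral => //.
  - by move=> x _; rewrite lee_fin mulr_ge0 ?sqr_ge0 ?normal_pdf_ge0.
  - by apply/measurable_EFinP/measurable_funM => //; exact: measurable_normal_pdf.
  - by apply/measurable_EFinP/measurable_funM => //; exact: measurable_normal_pdf.
  - by move=> x _; rewrite lee_fin sqr_normal_pdf_le.
rewrite ge0_integralZl//.
- by rewrite integral_normal_pdf mule1 ltry.
- by apply/measurable_EFinP; exact: measurable_normal_pdf.
- by move=> x _; rewrite lee_fin normal_pdf_ge0.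
Qed.

Section square_integrable.
Context (R : realType) (d : measure_display) (T : measurableType d)
  (P : probability T R).
Implicit Types X W Z : T -> R.

Definition square_integrable X : Prop :=
  measurable_fun setT X /\ P.-integrable setT (EFin \o (fun t => X t ^+ 2)).

Lemma le_square_integrable X W Z (a b : R) : measurable_fun setT X ->
  square_integrable W -> square_integrable Z ->
  (forall t, X t ^+ 2 <= a * W t ^+ 2 + b * Z t ^+ 2) -> square_integrable X.
Proof.
move=> mX [mW iW] [mZ iZ] le; split => //.
apply: (@le_integrable _ _ _ P setT measurableT _
  (fun t => a%:E * (W t ^+ 2)%:E + b%:E * (Z t ^+ 2)%:E)%E).
- by apply/measurable_EFinP; exact: measurable_funX.
- move=> t _; rewrite /= lee_fin ger0_norm ?sqr_ge0//.
  by apply: le_trans (le t) _; exact: ler_norm.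
- by apply: integrableD => //; exact: integrableZl.
Qed.

Lemma square_integrable_cst (c : R) : square_integrable (cst c).
Proof.
split => //; apply: (@bounded_integrable _ _ _ _ _ `|c ^+ 2|) => //.
  by rewrite [X in (X < _)%E]probability_setT ltry.
exact: measurable_funX.
Qed.

Lemma square_integrableD X W (a : R) : square_integrable X ->
  square_integrable W -> square_integrable (fun t => X t + a * W t).
Proof.
move=> sX sW.
apply: (@le_square_integrable _ X W 2 (2 * a ^+ 2)) => //.
  by apply: measurable_funD; [case: sX|apply: measurable_funM => //; case: sW].
move=> t; have := sqr_ge0 (X t - a * W t); nra.
Qed.

Lemma square_integrable_sub_cst X (c : R) : square_integrable X ->
  square_integrable (fun t => X t - c).
Proof.
move=> sX; have := square_integrableD (-1) sX (square_integrable_cst c).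
by under [X in square_integrable X -> _]eq_fun do rewrite mulN1r.
Qed.

Lemma square_integrable_integrable X : square_integrable X ->
  P.-integrable setT (EFin \o X).
Proof.
move=> [mX iX].
apply: (@le_integrable _ _ _ P setT measurableT _
  (fun t => (X t ^+ 2)%:E + (1 : R)%:E)%E).
- exact/measurable_EFinP.
- move=> t _; rewrite /= lee_fin [leRHS]ger0_norm ?addr_ge0 ?sqr_ge0//.
  by case: (ler0P (X t)) => _; have := sqr_ge0 (X t - 1); have := sqr_ge0 (X t + 1); nra.
- apply: integrableD => //; case: (square_integrable_cst 1) => _.
  by under eq_fun do rewrite expr1n.
Qed.

Lemma square_integrable_eq_law X W : measurable_fun setT W ->
  (forall A, measurable A -> P (X @^-1` A) = P (W @^-1` A)) ->
  square_integrable X -> square_integrable W.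
Proof.
move=> mW XW [mX iX]; split => //.
have mf : measurable_fun setT (fun x : R => (x ^+ 2)%:E).
  by apply/measurable_EFinP; exact: measurable_funX.
exact: (eq_law_integrable mX mW XW mf).
Qed.

Lemma integral_eq_law_opp X :
  P.-integrable setT (EFin \o X) ->
  (forall A, measurable A -> P (X @^-1` A) = P ((fun t => - X t) @^-1` A)) ->
  (\int[P]_t (X t)%:E = 0)%E.
Proof.
move=> iX XN.
have mX : measurable_fun setT X by have /measurable_EFinP := measurable_int _ iX.
have mN : measurable_fun setT (fun t => - X t) by exact: measurableT_comp.
have mE : measurable_fun setT (@EFin R) by exact/measurable_EFinP.
have H : (\int[P]_t (X t)%:E = \int[P]_t (- X t)%:E)%E.
  exact: (@eq_law_integral _ _ _ _ _ _ _ P P X _ mX mN XN (@EFin R) mE iX).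
have fX := integrable_fin_num measurableT iX.
move: H; under [in X in _ = X -> _]eq_integral do rewrite EFinN.
rewrite integralN//; last exact: integrable_add_def.
have := fX; rewrite /=; case: (\int[P]_t (X t)%:E)%E => [r| |]// _.
by rewrite -EFinN => -[rN]; congr EFin; lra.
Qed.

Lemma integral_sub_mean X : P.-integrable setT (EFin \o X) ->
  (\int[P]_t (X t - fine (\int[P]_t (X t)%:E))%:E = 0)%E.
Proof.
move=> iX; have fX := integrable_fin_num measurableT iX.
have i1 : P.-integrable setT (EFin \o cst (fine (\int[P]_t (X t)%:E)%E)).
  by apply: square_integrable_integrable; exact: square_integrable_cst.
under eq_integral do rewrite EFinB.
rewrite integralB// integral_cst// [X in (_ * X)%E]probability_setT mule1.
by rewrite fineK// subee.
Qed.

Lemma independent_integral_sqrB W Z : independent_rv P W Z ->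
  square_integrable W -> square_integrable Z -> (\int[P]_t (W t)%:E = 0)%E ->
  (\int[P]_t ((W t - Z t) ^+ 2)%:E =
   \int[P]_t (W t ^+ 2)%:E + \int[P]_t (Z t ^+ 2)%:E)%E.
Proof.
move=> WZ sW sZ W0; case: (sW) (sZ) => mW iW [mZ iZ].
have [iWZ eWZ] := independent_integralM WZ (square_integrable_integrable sW)
  (square_integrable_integrable sZ).
transitivity (\int[P]_t (((W t ^+ 2)%:E + (Z t ^+ 2)%:E) +
    (-2)%:E * (W t * Z t)%:E))%E.
  by apply: eq_integral => t _; rewrite -EFinM -!EFinD; congr EFin; ring.
rewrite integralD//; [|exact: integrableD|exact: integrableZl].
by rewrite integralD// integralZl// eWZ W0 mul0e mule0 adde0.
Qed.

End square_integrable.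

Lemma gaussian_vecP (R : realType) (d : measure_display) (T : measurableType d)
    (P : probability T R) (n : nat) (X : T -> n.-tuple R) (theta : n.-tuple R) (v : R) :
  (forall i, measurable_fun setT (fun t => tnth (X t) i)) ->
  (forall (u : 'I_n -> R) (A : set R), measurable A ->
    P ((fun t => \sum_i u i * tnth (X t) i) @^-1` A) =
    gauss1 (\sum_i u i * tnth theta i) (\sum_i u i ^+ 2 * v) A) ->
  gaussian_vec P X theta v.
Proof.
move=> mX H; split; first exact: mX.
move=> u A mA; apply: etrans (H u A mA) _; apply: eq_gauss1; first by [].
apply: eq_bigr => i _; rewrite (bigD1 i)//= eqxx big1 ?addr0 ?expr2//.
by move=> j ji; rewrite eq_sym (negbTE ji) mulr0.
Qed.

Lemma antithetic_gaussian_vec (R : realType) (d : measure_display)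
    (T : measurableType d) (P : probability T R) (n K : nat)
    (w : 'I_K -> T -> n.-tuple R) (s2 : R) (k : 'I_K) :
  antithetic P w s2 -> gaussian_vec P (w k) [tuple 0 | i < n] s2.
Proof.
move=> [mw law]; apply: gaussian_vecP => [i|u A mA]; first exact: (mw (k, i)).
pose u' (p : 'I_K * 'I_n) := if p.1 == k then u p.2 else 0.
have S (F : 'I_K * 'I_n -> R) :
    (forall p, p.1 != k -> F p = 0) -> \sum_p F p = \sum_i F (k, i).
  move=> F0; have -> : \sum_p F p = \sum_a \sum_b F (a, b).
    by rewrite pair_bigA; apply: eq_bigr => -[].
  rewrite (bigD1 k)//=.
  by rewrite [X in _ + X]big1 ?addr0// => j jk; rewrite big1// => i _; exact: F0.
have u'0 p : p.1 != k -> u' p = 0 by rewrite /u' => /negbTE ->.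
have u'k i : u' (k, i) = u i by rewrite /u' eqxx.
have -> : (fun t => \sum_i u i * tnth (w k t) i) =
    (fun t => \sum_p u' p * tnth (w p.1 t) p.2).
  apply/funext => t; rewrite S; last by move=> p pk; rewrite u'0// mul0r.
  by apply: eq_bigr => i _; rewrite u'k.
apply: etrans (law u' A mA) _; apply: eq_gauss1.
  by rewrite !big1// => i _; rewrite ?tnth_mktuple mulr0.
rewrite S; last first.
  by move=> p pk; rewrite big1// => q _; rewrite u'0// !mul0r.
apply: eq_bigr => i _; rewrite S; last first.
  by move=> p pk; rewrite (u'0 p)// mulr0 mul0r.
rewrite (bigD1 i)//= !eqxx big1 ?addr0.
  by rewrite u'k expr2.
by move=> j ji; rewrite eq_sym (negbTE ji) mulr0.
Qed.

Lemma independent_omega (R : realType) (d : measure_display)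
    (T : measurableType d) (P : probability T R) (n K : nat)
    (Y : T -> n.-tuple R) (w : 'I_K -> T -> n.-tuple R) (k : 'I_K) :
  independent_rv P Y (omega_tuple w) -> independent_rv P Y (w k).
Proof.
move=> YO.
have -> : w k = (fun x => tnth x k) \o omega_tuple w.
  by apply/funext => t /=; rewrite tnth_mktuple.
have -> : Y = id \o Y by [].
by apply: independent_rv_comp YO; [exact: measurable_id|exact: measurable_tnth].
Qed.

Section randomization.
Context (R : realType) (d : measure_display) (T : measurableType d)
  (P : probability T R) (n : nat) (theta : n.-tuple R) (s2 a : R)
  (Y W : T -> n.-tuple R).
Hypothesis s2_gt0 : 0 < s2.
Hypothesis a_gt0 : 0 < a.
Hypothesis gY : gaussian_vec P Y theta s2.
Hypothesis gW : gaussian_vec P W [tuple 0 | i < n] s2.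
Hypothesis YW : independent_rv P Y W.

Let U (i : 'I_n) t : R := tnth (Y t) i - a^-1 * tnth (W t) i.
Let V t : n.-tuple R := vadd (Y t) (vscale a (W t)).

Let VE t i : tnth (V t) i = tnth (Y t) i + a * tnth (W t) i.
Proof. by rewrite /V /vadd /vscale !tnth_mktuple. Qed.

Let mY := gaussian_vec_measurable_tnth gY.
Let mW := gaussian_vec_measurable_tnth gW.

Let mU i : measurable_fun setT (U i).
Proof. by apply: measurable_funB => //; exact: measurable_funM. Qed.

Let mVi i : measurable_fun setT (fun t => tnth (V t) i).
Proof.
under eq_fun do rewrite VE.
by apply: measurable_funD => //; exact: measurable_funM.
Qed.

Let mV : measurable_fun setT V.
Proof. by apply/measurable_fun_tnthP. Qed.

(* The covariance of [U] and [V] is [s2 - s2 = 0]. *)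
Let law_UV (c u : 'I_n -> R) (A : set R) : measurable A ->
  P ((fun t => \sum_i c i * U i t + \sum_i u i * tnth (V t) i) @^-1` A) =
  gauss1 (\sum_i c i * tnth theta i + \sum_i u i * tnth theta i)
    (\sum_i c i ^+ 2 * (s2 * (1 + a ^- 2)) + \sum_i u i ^+ 2 * (s2 * (1 + a ^+ 2))) A.
Proof.
move=> mA.
pose p i := c i + u i; pose q i := a * u i - c i / a.
have -> : (fun t => \sum_i c i * U i t + \sum_i u i * tnth (V t) i) =
    (fun t => \sum_i p i * tnth (Y t) i + \sum_i q i * tnth (W t) i).
  apply/funext => t; rewrite -!big_split/=; apply: eq_bigr => i _.
  by rewrite VE /U /p /q; ring.
have mp (x : 'I_n -> R) : measurable_fun setT (fun z : n.-tuple R => \sum_i x i * tnth z i).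
  by apply: measurable_sum => i; apply: measurable_funM => //; exact: measurable_tnth.
have [_ [_ ind]] := independent_rv_comp (mp p) (mp q) YW.
have v0 (x : 'I_n -> R) : 0 <= \sum_i x i ^+ 2 * s2.
  by apply: sumr_ge0 => i _; rewrite mulr_ge0 ?sqr_ge0 ?ltW.
apply: etrans (gauss1_conv (X := fun t => \sum_i p i * tnth (Y t) i)
  (Z := fun t => \sum_i q i * tnth (W t) i) (m1 := \sum_i p i * tnth theta i)
  (m2 := \sum_i q i * tnth [tuple (0 : R) | i < n] i) _ _ (v0 p) (v0 q) _ mA) _.
- by apply: measurable_sum => i; exact: measurable_funM.
- by apply: measurable_sum => i; exact: measurable_funM.
- move=> B C mB mC; apply: etrans (ind B C mB mC) _.
  by congr (_ * _)%E; [exact: (gaussian_vec_law gY)|exact: (gaussian_vec_law gW)].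
- apply: eq_gauss1; rewrite -!big_split/=; apply: eq_bigr => i _.
    by rewrite tnth_mktuple mulr0 addr0 /p mulrDl.
  by rewrite /p /q; field; rewrite gt_eqF.
Qed.

Lemma gaussian_vec_randomized : gaussian_vec P V theta (s2 * (1 + a ^+ 2)).
Proof.
apply: gaussian_vecP => // u A mA.
have := law_UV (fun=> 0) u mA.
rewrite [X in gauss1 (X + _) _]big1; last by move=> i _; rewrite mul0r.
rewrite [X in gauss1 _ (X + _)]big1; last by move=> i _; rewrite expr0n mul0r.
rewrite !add0r => <-; congr (P (_ @^-1` A)); apply/funext => t.
by rewrite [X in _ = X + _]big1 ?add0r// => i _; rewrite mul0r.
Qed.

Lemma independent_randomized i : independent_rv P (U i) V.
Proof.
apply: (gauss_independent_rv (m0 := tnth theta i) (v0 := s2 * (1 + a ^- 2))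
  (m := fun i => tnth theta i) (v := fun=> s2 * (1 + a ^+ 2))) => //.
- by rewrite mulr_ge0 ?(ltW s2_gt0)// addr_ge0// invr_ge0 sqr_ge0.
- by move=> _; rewrite mulr_ge0 ?(ltW s2_gt0)// addr_ge0// sqr_ge0.
move=> c u A mA.
have S (f : 'I_n -> R) : \sum_j (if j == i then c else 0) * f j = c * f i.
  rewrite (bigD1 i)//= eqxx big1 ?addr0// => j ji.
  by rewrite (negbTE ji) mul0r.
have S2 (x : R) : \sum_j (if j == i then c else 0) ^+ 2 * x = c ^+ 2 * x.
  rewrite (bigD1 i)//= eqxx big1 ?addr0// => j ji.
  by rewrite (negbTE ji) expr0n mul0r.
have := law_UV (fun j => if j == i then c else 0) u mA.
rewrite S S2 => <-; congr (P (_ @^-1` A)); apply/funext => t.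
by rewrite (S (U^~ t)).
Qed.

Lemma gaussian_vec_square_integrable (X : T -> n.-tuple R) m i :
  gaussian_vec P X m s2 -> square_integrable P (fun t => tnth (X t) i).
Proof.
move=> gX; have mX := gaussian_vec_measurable_tnth gX.
have sX : square_integrable P (fun t => tnth (X t) i - tnth m i).
  split; first exact: measurable_funB.
  exact: (gauss1_integrable_sqr s2_gt0 (mX i) (gaussian_vec_law1 gX i)).
have := square_integrableD 1 sX (square_integrable_cst P (tnth m i)).
by under [X in square_integrable P X -> _]eq_fun do rewrite mul1r subrK.
Qed.

Lemma centered_gaussian_integral i : (\int[P]_t (tnth (W t) i)%:E = 0)%E.
Proof.
apply: integral_eq_law_opp.
  exact/square_integrable_integrable/(gaussian_vec_square_integrable _ gW).
move=> A mA; apply: etrans (gaussian_vec_law1 gW i mA) _.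
have S (f : 'I_n -> R) : \sum_j (if j == i then -1 else 0) * f j = - f i.
  rewrite (bigD1 i)//= eqxx big1 ?addr0 ?mulN1r// => j ji.
  by rewrite (negbTE ji) mul0r.
have -> : (fun t => - tnth (W t) i) =
    (fun t => \sum_j (if j == i then -1 else 0) * tnth (W t) j).
  by apply/funext => t; rewrite S.
apply/esym; apply: etrans (gaussian_vec_law gW _ mA) _; apply: eq_gauss1.
  by rewrite S tnth_mktuple oppr0.
rewrite (bigD1 i)//= eqxx big1 ?addr0 ?sqrrN ?expr1n ?mul1r// => j ji.
by rewrite (negbTE ji) expr0n mul0r.
Qed.

Let mean i : R := fine (\int[P]_t (tnth (Y t) i)%:E)%E.

Let sY i := gaussian_vec_square_integrable i gY.
Let sW i := gaussian_vec_square_integrable i gW.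

Let sU i : square_integrable P (U i).
Proof.
have := square_integrableD (- a^-1) (sY i) (sW i).
by under [X in square_integrable P X -> _]eq_fun do rewrite mulNr.
Qed.

Lemma square_integrable_randomized i (f : n.-tuple R -> R) : measurable_fun setT f ->
  square_integrable P (fun t => U i t - f (V t)) ->
  square_integrable P (f \o V).
Proof.
move=> mf sUf.
have := square_integrableD (-1) (sU i) sUf.
rewrite (_ : (fun t => _) = f \o V)//.
by apply/funext => t /=; ring.
Qed.

Let center_U i :
  (\int[P]_t ((U i t - mean i) ^+ 2)%:E =
   \int[P]_t ((tnth (Y t) i - mean i) ^+ 2)%:E +
   \int[P]_t (a ^- 2 * tnth (W t) i ^+ 2)%:E)%E.
Proof.
have sYc := square_integrable_sub_cst (mean i) (sY i).
have saW : square_integrable P (fun t => a^-1 * tnth (W t) i).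
  have := square_integrableD a^-1 (square_integrable_cst P 0) (sW i).
  by under [X in square_integrable P X -> _]eq_fun do rewrite add0r.
have m1 : measurable_fun setT (fun y : n.-tuple R => tnth y i - mean i).
  by apply: measurable_funB => //; exact: measurable_tnth.
have m2 : measurable_fun setT (fun y : n.-tuple R => a^-1 * tnth y i).
  by apply: measurable_funM => //; exact: measurable_tnth.
have ind := independent_rv_comp m1 m2 YW.
have := independent_integral_sqrB ind sYc saW
  (integral_sub_mean (square_integrable_integrable (sY i))).
under [in X in _ = (_ + X)%E -> _]eq_integral do rewrite /= exprMn exprVn.
move=> <-; apply: eq_integral => t _; congr EFin.
by rewrite /U /=; ring.
Qed.

Lemma randomized_risk i (f : n.-tuple R -> R) : measurable_fun setT f ->
  square_integrable P (f \o V) ->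
  P.-integrable setT (EFin \o (fun t => (U i t - f (V t)) ^+ 2 -
    a ^- 2 * tnth (W t) i ^+ 2)) /\
  (\int[P]_t ((U i t - f (V t)) ^+ 2 - a ^- 2 * tnth (W t) i ^+ 2)%:E =
   \int[P]_t ((tnth (Y t) i - mean i) ^+ 2)%:E +
   \int[P]_t ((f (V t) - mean i) ^+ 2)%:E)%E.
Proof.
move=> mf sf.
have [_ iaW] : square_integrable P (fun t => a^-1 * tnth (W t) i).
  have := square_integrableD a^-1 (square_integrable_cst P 0) (sW i).
  by under [X in square_integrable P X -> _]eq_fun do rewrite add0r.
have {}iaW : P.-integrable setT (EFin \o (fun t => a ^- 2 * tnth (W t) i ^+ 2)).
  by apply: eq_integrable iaW => // t _; rewrite /= exprMn exprVn.
have [_ iUf] : square_integrable P (fun t => U i t - f (V t)).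
  have := square_integrableD (-1) (sU i) sf.
  by under [X in square_integrable P X -> _]eq_fun do rewrite mulN1r.
split; first exact: (integrableB measurableT iUf iaW).
under eq_integral do rewrite EFinB.
rewrite integralB//.
have m1 : measurable_fun setT (fun x : R => x - mean i) by exact: measurable_funB.
have m2 : measurable_fun setT (fun x => f x - mean i) by exact: measurable_funB.
have ind := independent_rv_comp m1 m2 (independent_randomized i).
have sUc := square_integrable_sub_cst (mean i) (sU i).
have sfc := square_integrable_sub_cst (mean i) sf.
have EU : (\int[P]_t (U i t - mean i)%:E = 0)%E.
  have iY := square_integrable_integrable (sY i).
  have iYc := square_integrable_integrable (square_integrable_sub_cst (mean i) (sY i)).
  have iW := square_integrable_integrable (sW i).
  transitivity (\int[P]_t ((tnth (Y t) i - mean i)%:E + (- a^-1)%:E * (tnth (W t) i)%:E))%E.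
    by apply: eq_integral => t _; rewrite -EFinM -EFinD /U; congr EFin; ring.
  rewrite integralD//; last exact: integrableZl.
  by rewrite integralZl// centered_gaussian_integral mule0 adde0 integral_sub_mean.
have H := independent_integral_sqrB ind sUc sfc EU.
rewrite (_ : (\int[P]_t ((U i t - f (V t)) ^+ 2)%:E)%E =
    (\int[P]_t ((((fun x => x - mean i) \o U i) t -
    ((fun x => f x - mean i) \o V) t) ^+ 2)%:E)%E); last first.
  by apply: eq_integral => t _; congr EFin; rewrite /=; ring.
have faW := integrable_fin_num measurableT iaW.
rewrite H center_U.
have cancel (x y z : \bar R) : y \is a fin_num -> (x + y + z - y = x + z)%E.
  by move=> fy; rewrite addeAC addeK.
exact: cancel.
Qed.

End randomization.

Lemma independent_rv_sym (R : realType) (d d1 d2 : measure_display)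
    (T : measurableType d) (T1 : measurableType d1) (T2 : measurableType d2)
    (P : probability T R) (X : T -> T1) (Z : T -> T2) :
  independent_rv P X Z -> independent_rv P Z X.
Proof.
by move=> [mX [mZ XZ]]; split=> //; split=> // A B mA mB; rewrite setIC XZ// muleC.
Qed.

Lemma square_integrable_gaussian_vec (R : realType) (d d' : measure_display)
    (T : measurableType d) (T' : measurableType d') (P : probability T R)
    (P' : probability T' R) (n : nat) (X : T -> n.-tuple R) (X' : T' -> n.-tuple R)
    (theta : n.-tuple R) (v v0 : R) (f : n.-tuple R -> R) :
  0 < v -> v <= v0 -> gaussian_vec P X theta v -> gaussian_vec P' X' theta v0 ->
  measurable_fun setT f -> square_integrable P' (f \o X') ->
  square_integrable P (f \o X).
Proof.
move=> vp vv0 gX gX' mf [_ iX']; have v0p := lt_le_trans vp vv0.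
have mX := gaussian_vec_measurable gX; have mX' := gaussian_vec_measurable gX'.
split; first exact: measurableT_comp.
have mf2 : measurable_fun setT (fun x => f x ^+ 2) by exact: measurable_funX.
apply/integrableP; split.
  by apply/measurable_EFinP; exact: (measurableT_comp mf2).
under eq_integral do rewrite /= ger0_norm ?sqr_ge0//.
rewrite (ge0_integral_gaussian_vec vp v0p gX gX' mf2 (fun x => sqr_ge0 _)).
have := integrable_vec_ratio theta vp vv0 mX' mf2 iX'.
move=> /integrableP[_]; apply: le_lt_trans; rewrite le_eqVlt; apply/orP; left.
apply/eqP; apply: eq_integral => t _; rewrite /= ger0_norm//.
by rewrite mulr_ge0 ?sqr_ge0 ?vec_ratio_ge0.
Qed.

Lemma CV_sum (T : Type) (R : realType) (n K : nat) (g : n.-tuple R -> n.-tuple R)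
    (Y : T -> n.-tuple R) (w : 'I_K -> T -> n.-tuple R) (alpha : R) t : 0 < alpha ->
  CV g Y w alpha t = K%:R^-1 * \sum_(k < K) \sum_(i < n)
    ((tnth (Y t) i - (Num.sqrt alpha)^-1 * tnth (w k t) i -
      tnth (g (vadd (Y t) (vscale (Num.sqrt alpha) (w k t)))) i) ^+ 2 -
     Num.sqrt alpha ^- 2 * tnth (w k t) i ^+ 2).
Proof.
move=> a0; congr (_ * _); apply: eq_bigr => k _.
rewrite /sqnorm mulr_sumr -sumrB; apply: eq_bigr => i _.
by rewrite /vsub !tnth_mktuple sqr_sqrtr// ltW.
Qed.

Section cross_validation.
Context (R : realType) (d : measure_display) (T : measurableType d)
  (P : probability T R) (n K : nat) (theta : n.-tuple R) (s2 : R)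
  (Y Yt : T -> n.-tuple R) (w : 'I_K -> T -> n.-tuple R)
  (g : n.-tuple R -> n.-tuple R) (alpha0 : R) (k0 : 'I_K).
Hypothesis s2_gt0 : 0 < s2.
Hypothesis gY : gaussian_vec P Y theta s2.
Hypothesis mYt : measurable_fun setT Yt.
Hypothesis YYt : forall A : set (n.-tuple R), measurable A ->
  P (Yt @^-1` A) = P (Y @^-1` A).
Hypothesis indYt : independent_rv P Y Yt.
Hypothesis aw : antithetic P w s2.
Hypothesis indw : independent_rv P Y (omega_tuple w).
Hypothesis mg : measurable_fun setT g.
Hypothesis alpha0_gt0 : 0 < alpha0.
Hypothesis iCV : P.-integrable setT (EFin \o CV g Y w alpha0).

Let gw k := antithetic_gaussian_vec k aw.
Let indwk k := independent_omega k indw.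

Let mgi i : measurable_fun setT (fun x => tnth (g x) i).
Proof. exact: (measurableT_comp (measurable_tnth i) mg). Qed.

Let V alpha k t := vadd (Y t) (vscale (Num.sqrt alpha) (w k t)).

Let var alpha := s2 * (1 + alpha).

Let gV alpha k : 0 < alpha -> gaussian_vec P (V alpha k) theta (var alpha).
Proof.
move=> a0; have sa : 0 < Num.sqrt alpha by rewrite sqrtr_gt0.
have := gaussian_vec_randomized s2_gt0 sa gY (gw k) (indwk k).
by rewrite sqr_sqrtr// ltW.
Qed.

Let sgV0 i : square_integrable P (fun t => tnth (g (V alpha0 k0 t)) i).
Proof.
have sa : 0 < Num.sqrt alpha0 by rewrite sqrtr_gt0.
apply: (square_integrable_randomized s2_gt0 gY (gw k0) (mgi i)
  (a := Num.sqrt alpha0) (i := i)).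
have mUg j : measurable_fun setT (fun t => tnth (Y t) j -
    (Num.sqrt alpha0)^-1 * tnth (w k0 t) j - tnth (g (V alpha0 k0 t)) j).
  apply: measurable_funB.
    apply: measurable_funB; first exact: (gaussian_vec_measurable_tnth gY).
    by apply: measurable_funM => //; exact: (gaussian_vec_measurable_tnth (gw k0)).
  by apply: (measurableT_comp (mgi j)); exact: (gaussian_vec_measurable (gV _ _)).
split; first exact: mUg.
pose N t : R := \sum_(k < K) \sum_(j < n)
  (Num.sqrt alpha0 ^- 2 * tnth (w k t) j ^+ 2).
have iN : P.-integrable setT (EFin \o N).
  rewrite (_ : _ \o _ = (fun t => \sum_(k < K) \sum_(j < n)
    (Num.sqrt alpha0 ^- 2)%:E * (tnth (w k t) j ^+ 2)%:E)%E); last first.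
    apply/funext => t; rewrite /N /= -sumEFin; apply: eq_bigr => k _.
    by rewrite -sumEFin.
  apply: integrable_sum => // k _; apply: integrable_sum => // j _.
  apply: integrableZl => //.
  by have [] := gaussian_vec_square_integrable s2_gt0 j (gw k).
apply: (@le_integrable _ _ _ P setT measurableT _
  (fun t => (K%:R : R)%:E * (EFin \o CV g Y w alpha0) t + (EFin \o N) t)%E).
- by apply/measurable_EFinP; exact: measurable_funX.
- move=> t _; rewrite /= lee_fin ger0_norm ?sqr_ge0//.
  apply: le_trans (ler_norm _); rewrite CV_sum//.
  have Kn0 : K%:R != 0 :> R by rewrite pnatr_eq0 -lt0n (leq_ltn_trans _ (ltn_ord k0)).
  rewrite mulVKf// /N -big_split/= (bigD1 k0)//= -big_split/=.
  under eq_bigr do rewrite subrK.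
  rewrite (bigD1 i)//= -addrA lerDl addr_ge0//; first by rewrite sumr_ge0// => j _; rewrite sqr_ge0.
  apply: sumr_ge0 => k _; rewrite -big_split/=; apply: sumr_ge0 => j _.
  by rewrite subrK sqr_ge0.
- by apply: integrableD => //; exact: integrableZl.
Qed.

Let v0 := var alpha0.

Let var_gt0 alpha : 0 <= alpha -> 0 < var alpha.
Proof. by move=> a0; rewrite mulr_gt0// ltr_pwDl. Qed.

Let var_le alpha : alpha <= alpha0 -> var alpha <= v0.
Proof. by move=> a; rewrite ler_pM2l// lerD2l. Qed.

Let mean i : R := fine (\int[P]_t (tnth (Y t) i)%:E)%E.
Let h (x : n.-tuple R) : R := \sum_i (tnth (g x) i - mean i) ^+ 2.

Let mh : measurable_fun setT h.
Proof.
apply: measurable_sum => i; apply: measurable_funX.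
exact: measurable_funB.
Qed.

Let h_ge0 x : 0 <= h x.
Proof. by apply: sumr_ge0 => i _; exact: sqr_ge0. Qed.

Let X0 := V alpha0 k0.
Let gX0 : gaussian_vec P X0 theta v0. Proof. exact: gV. Qed.
Let mX0 := gaussian_vec_measurable gX0.

Let ih : P.-integrable setT (EFin \o h \o X0).
Proof.
rewrite (_ : _ \o _ = (fun t => \sum_i ((tnth (g (X0 t)) i - mean i) ^+ 2)%:E)%E).
  apply: integrable_sum => // i _.
  by have [] := square_integrable_sub_cst (mean i) (sgV0 i).
by apply/funext => t; rewrite /= sumEFin.
Qed.

Let S : \bar R := (\sum_i \int[P]_t ((tnth (Y t) i - mean i) ^+ 2)%:E)%E.
Let H alpha : \bar R := (\int[P]_t (h (X0 t) * vec_ratio theta v0 (var alpha) (X0 t))%:E)%E.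

Let S_fin : S \is a fin_num.
Proof.
apply/sum_fin_numP => i _ _.
have [_ iY] := square_integrable_sub_cst (mean i)
  (gaussian_vec_square_integrable s2_gt0 i gY).
exact: (integrable_fin_num measurableT iY).
Qed.

Let H_fin alpha : 0 <= alpha -> alpha <= alpha0 -> H alpha \is a fin_num.
Proof.
move=> a0 a1.
have iH := integrable_vec_ratio theta (var_gt0 a0) (var_le a1) mX0 mh ih.
exact: (integrable_fin_num measurableT iH).
Qed.

Let sum_gaussian alpha (X : T -> n.-tuple R) : 0 <= alpha -> alpha <= alpha0 ->
  gaussian_vec P X theta (var alpha) ->
  (forall i, square_integrable P (fun t => tnth (g (X t)) i)) /\
  (\sum_i \int[P]_t ((tnth (g (X t)) i - mean i) ^+ 2)%:E = H alpha)%E.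
Proof.
move=> a0 a1 gX.
split=> [i|].
  exact: (square_integrable_gaussian_vec (var_gt0 a0) (var_le a1) gX gX0 (mgi i) (sgV0 i)).
have v0_gt0 : 0 < v0 by apply: var_gt0; exact: ltW.
rewrite /H -(ge0_integral_gaussian_vec (var_gt0 a0) v0_gt0 gX gX0 mh h_ge0).
under [RHS]eq_integral do rewrite -sumEFin.
rewrite ge0_integral_sum//.
  move=> i; apply/measurable_EFinP/measurable_funX/measurable_funB => //.
  by apply: (measurableT_comp (mgi i)); exact: gaussian_vec_measurable gX.
by move=> i t _; rewrite lee_fin sqr_ge0.
Qed.

Lemma expectation_CV alpha : 0 < alpha -> alpha <= alpha0 ->
  'E_P[CV g Y w alpha]%E = (S + H alpha)%E.
Proof.
move=> a0 a1; have sa : 0 < Num.sqrt alpha by rewrite sqrtr_gt0.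
have risk k i := randomized_risk s2_gt0 sa gY (gw k) (indwk k) i (mgi i)
  ((sum_gaussian (ltW a0) a1 (gV k a0)).1 i).
have Kn0 : K%:R != 0 :> R by rewrite pnatr_eq0 -lt0n (leq_ltn_trans _ (ltn_ord k0)).
rewrite unlock.
transitivity (\int[P]_t ((K%:R^-1)%:E * \sum_(k < K) \sum_(i < n)
    ((tnth (Y t) i - (Num.sqrt alpha)^-1 * tnth (w k t) i -
      tnth (g (V alpha k t)) i) ^+ 2 -
     Num.sqrt alpha ^- 2 * tnth (w k t) i ^+ 2)%:E))%E.
  apply: eq_integral => t _; rewrite CV_sum// EFinM; congr (_ * _)%E.
  by rewrite -sumEFin; apply: eq_bigr => k _; rewrite -sumEFin.
rewrite integralZl//; last first.
  by apply: integrable_sum => // k _; apply: integrable_sum => // i _; case: (risk k i).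
rewrite integral_sum//; last first.
  by move=> k; apply: integrable_sum => // i _; case: (risk k i).
transitivity ((K%:R^-1)%:E * \sum_(k < K) (S + H alpha))%E.
  congr (_ * _)%E; apply: eq_bigr => k _; rewrite integral_sum//; last first.
    by move=> i; case: (risk k i).
  rewrite -(sum_gaussian (ltW a0) a1 (gV k a0)).2 -big_split/=.
  by apply: eq_bigr => i _; case: (risk k i).
have fSH : (S + H alpha)%E \is a fin_num by rewrite fin_numD S_fin H_fin// ltW.
rewrite -(fineK fSH) sumEFin -EFinM sumr_const card_ord -[X in _ * X]mulr_natl.
by rewrite mulKf.
Qed.

Lemma prediction_error :
  'E_P[fun t => sqnorm (vsub (g (Y t)) (Yt t))]%E = (S + H 0)%E.
Proof.
have gY' : gaussian_vec P Y theta (var 0) by rewrite /var addr0 mulr1.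
have [sg <-] := sum_gaussian (lexx 0) (ltW alpha0_gt0) gY'.
rewrite unlock -big_split/=.
under eq_integral do rewrite /sqnorm -sumEFin.
rewrite ge0_integral_sum//; first last.
- by move=> i t _; rewrite lee_fin sqr_ge0.
- move=> i; apply/measurable_EFinP/measurable_funX.
  rewrite /vsub; under eq_fun do rewrite tnth_mktuple.
  apply: measurable_funB; last exact: (measurableT_comp (measurable_tnth i) mYt).
  by case: (sg i).
apply: eq_bigr => i _.
have mi : measurable_fun setT (fun x : n.-tuple R => tnth x i) by exact: measurable_tnth.
have mYti : measurable_fun setT (fun t => tnth (Yt t) i) by exact: (measurableT_comp mi mYt).
have mYi := gaussian_vec_measurable_tnth gY i.
have law (A : set R) : measurable A ->
    P ((fun t => tnth (Y t) i) @^-1` A) = P ((fun t => tnth (Yt t) i) @^-1` A).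
  move=> mA; apply/esym; apply: (YYt (A := (fun x => tnth x i) @^-1` A)).
  by rewrite -[X in measurable X]setTI; exact: mi.
have sY := gaussian_vec_square_integrable s2_gt0 i gY.
have sYt := square_integrable_eq_law mYti law sY.
have m1 : measurable_fun setT (fun x : n.-tuple R => tnth x i - mean i).
  exact: measurable_funB.
have m2 : measurable_fun setT (fun x : n.-tuple R => tnth (g x) i - mean i).
  exact: measurable_funB.
have ind := independent_rv_comp m1 m2 (independent_rv_sym indYt).
have EYt : (\int[P]_t (tnth (Yt t) i - mean i)%:E = 0)%E.
  have mE : measurable_fun setT (fun x : R => (x - mean i)%:E).
    by apply/measurable_EFinP; exact: measurable_funB.
  have iYc := square_integrable_integrable (square_integrable_sub_cst (mean i) sY).
  rewrite -(eq_law_integral mYi mYti law mE iYc).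
  exact: (integral_sub_mean (square_integrable_integrable sY)).
have E := independent_integral_sqrB ind (square_integrable_sub_cst (mean i) sYt)
  (square_integrable_sub_cst (mean i) (sg i)) EYt.
have EE : (\int[P]_t ((tnth (Y t) i - mean i) ^+ 2)%:E =
    \int[P]_t ((tnth (Yt t) i - mean i) ^+ 2)%:E)%E.
  have mE : measurable_fun setT (fun x : R => ((x - mean i) ^+ 2)%:E).
    by apply/measurable_EFinP/measurable_funX; exact: measurable_funB.
  apply: (ge0_eq_law_integral mYi mYti law mE) => x.
  by rewrite lee_fin sqr_ge0.
rewrite EE; apply: etrans E; apply: eq_integral => t _; congr EFin.
by rewrite /vsub tnth_mktuple /=; ring.
Qed.

Lemma cvg_expectation_CV :
  ('E_P[CV g Y w alpha] @[alpha --> 0^'+] -->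
     'E_P[fun t => sqnorm (vsub (g (Y t)) (Yt t))])%E.
Proof.
pose phi alpha : R := fine (S + H (Num.min alpha alpha0))%E.
have fSH alpha : 0 <= alpha -> alpha <= alpha0 -> (S + H alpha)%E \is a fin_num.
  by move=> a b; rewrite fin_numD S_fin H_fin.
have min_ge0 alpha : 0 <= alpha -> 0 <= Num.min alpha alpha0.
  by move=> a; rewrite le_min a ltW.
have min_le alpha : Num.min alpha alpha0 <= alpha0 by rewrite ge_min lexx orbT.
rewrite prediction_error.
apply: (@cvg_trans _ ((phi alpha)%:E @[alpha --> 0^'+])).
  apply: near_eq_cvg; near=> alpha.
  have a0 : 0 < alpha by near: alpha; exact: nbhs_right_gt.
  have a1 : alpha <= alpha0 by near: alpha; exact: nbhs_right_le.
  rewrite /phi (min_idPl a1) fineK; last by apply: fSH => //; exact: ltW.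
  by rewrite expectation_CV.
rewrite -(fineK (fSH 0 (lexx _) (ltW alpha0_gt0))).
apply: cvg_EFin; first exact: nearW.
apply/cvg_at_rightP => u [u0 uc].
pose b k := Num.min (u k) alpha0.
have bc : b k @[k --> \oo] --> (0 : R).
  apply: (cvg_trans _ uc); apply: near_eq_cvg; near=> k.
  apply/esym/min_idPl/ltW; near: k.
  exact: (cvgr_lt 0 uc).
have vc : var (b k) @[k --> \oo] --> var 0.
  by apply: cvgMr; apply: cvgD => //; exact: cvg_cst.
have bv k : var 0 <= var (b k) <= v0.
  apply/andP; split; last by apply: var_le; exact: min_le.
  by rewrite ler_pM2l// lerD2l min_ge0// ltW.
have Hc := cvg_integral_vec_ratio (theta := theta) (var_gt0 (lexx 0)) mX0 mh ih bv vc.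
have SHc : (S + H (b k) @[k --> \oo] --> (fine (S + H 0))%:E)%E.
  rewrite fineK; last by apply: fSH => //; exact: ltW.
  apply: cvgeD (cvg_cst _) Hc.
  exact: fin_num_adde_defr.
exact: (fine_cvg SHc).
Unshelve. all: by end_near. Qed.

End cross_validation.

Theorem theorem1 (d : measure_display) (T : measurableType d) (R : realType)
    (P : probability T R) (n K : nat) (theta : n.-tuple R) (s2 : R)
    (Y Yt : T -> n.-tuple R) (w : 'I_K -> T -> n.-tuple R)
    (g : n.-tuple R -> n.-tuple R) :
  (1 <= n)%N -> (2 <= K)%N -> 0 < s2 ->
  gaussian_vec P Y theta s2 ->
  (* Yt is an independent copy of Y *)
  measurable_fun setT Yt ->
  (forall A : set (n.-tuple R), measurable A -> P (Yt @^-1` A) = P (Y @^-1` A)) ->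
  independent_rv P Y Yt ->
  (* antithetic randomization, independent of Y *)
  antithetic P w s2 ->
  independent_rv P Y (omega_tuple w) ->
  measurable_fun setT g ->
  ('E_P[fun t => sqnorm (g (Y t))] < +oo)%E ->
  (* well-definedness of E[CV_alpha] for small alpha (see NOTES.md) *)
  (\forall alpha \near 0^'+, P.-integrable setT (EFin \o CV g Y w alpha)) ->
  ('E_P[CV g Y w alpha] @[alpha --> 0^'+] -->
     'E_P[fun t => sqnorm (vsub (g (Y t)) (Yt t))])%E.
Proof.
move=> _ K2 s2p gY mYt YYt indYt aw indw mg _ iCV.
have k0 : 'I_K by exact: Ordinal (ltnW K2).
near (0 : R)^'+ => alpha.
apply: (@cvg_expectation_CV _ _ _ _ _ _ _ _ _ _ _ _ alpha k0 s2p gY mYt YYt indYt aw indw mg).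
- by near: alpha; exact: nbhs_right_gt.
- by near: alpha.
Unshelve. all: by end_near. Qed.
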